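(* Let $f(\xi)\in\mathbb{Z}_p[\xi_1,\ldots,\xi_n]$ be a quasielliptic polynomial of degree $d$ with respect to $\boldsymbol{w}$, let $\alpha>0$ and let $\beta\geq\alpha$. Then the operator $$\boldsymbol{f}(D;\alpha):\widetilde{H}_\beta\to\widetilde{H}_{\beta-\alpha},\qquad \phi\mapsto\boldsymbol{f}(D;\alpha)\phi,$$ is a bicontinuous isomorphism of Banach spaces.
   Context: $p$ is a prime, $|\cdot|_p$ the $p$-adic absolute value on $\mathbb{Q}_p$. A non-constant polynomial $f(\xi)\in\mathbb{Q}_p[\xi_1,\ldots,\xi_n]$ is called quasielliptic of degree $d$ with respect to $\boldsymbol{w}=(w_1,\ldots,w_n)\in(\mathbb{N}\setminus\{0\})^n$ if: (Q1) $f(\lambda^{w_1}\xi_1,\ldots,\lambda^{w_n}\xi_n)=\lambda^d f(\xi)$ for all $\lambda\in\mathbb{Q}_p^\times$; and (Q2) $f(\xi)=0\Leftrightarrow \xi=0$. By convention all quasielliptic polynomials are assumed to have coefficients in $\mathbb{Z}_p$. Set $\Xi(\xi)=\sum_{i=1}^n|\xi_i|_p^{d/w_i}$. $S=S(\mathbb{Q}_p^n)$ is the space of Schwartz--Bruhat functions (locally constant, compactly supported, complex-valued). $\Psi:\mathbb{Q}_p\to\mathbb{C}^\times$ is the standard additive character ($\mathbb{Q}_p\to\mathbb{Q}_p/\mathbb{Z}_p\hookrightarrow\mathbb{Q}/\mathbb{Z}\to\mathbb{C}^\times$, $b\mapsto e^{2\pi i b}$), and $(\mathcal{F}\phi)(\xi)=\int_{\mathbb{Q}_p^n}\Psi(-x\cdot\xi)\phi(x)\,d^nx$,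 with $d^nx$ the Haar measure normalized by $\mathrm{vol}(\mathbb{Z}_p^n)=1$. For a real $\beta\geq0$ put $\|\phi\|_\beta^2=\int_{\mathbb{Q}_p^n}\Xi^{2\beta}(\xi)|\mathcal{F}(\phi)(\xi)|^2d^n\xi$. Let $\Phi=\{\phi\in S:\mathcal{F}(\phi)(0)=0\}$, and let $\widetilde{H}_\beta=\widetilde{H}_\beta(\mathbb{Q}_p^n)$ be the completion of $(\Phi,\|\cdot\|_\beta)$. The operator $\boldsymbol{f}(D;\alpha)$ is defined on $\Phi$ by $\boldsymbol{f}(D;\alpha)\phi=\mathcal{F}^{-1}(|f(\xi)|_p^\alpha\mathcal{F}(\phi))$; it maps $(\Phi,\|\cdot\|_\beta)$ continuously into $(\Phi,\|\cdot\|_{\beta-\alpha})$, and the same symbol denotes its extension by density to $\widetilde{H}_\beta\to\widetilde{H}_{\beta-\alpha}$. *)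

(* Defs.v *)
From HB Require Import structures.
From mathcomp Require Import all_boot all_order all_algebra fraction generic_quotient.
From mathcomp Require Import complex.
From mathcomp Require Import all_classical all_reals all_analysis.
From mathcomp Require mpoly.

Set Implicit Arguments.
Unset Strict Implicit.
Unset Printing Implicit Defensive.

Import Order.TTheory GRing.Theory Num.Theory.
Import numFieldNormedType.Exports.

Local Open Scope classical_set_scope.
Local Open Scope ring_scope.

(* The ring of p-adic integers is the inverse limit of the rings Z/p^n; the
   component of index n is represented by its remainder modulo p^n.  Carrying
   the primality proof as a parameter lets the integral domain structure be
   inferred. *)
Record padicZ (p : nat) (p_pr : prime p) := PadicZ {
  residue : nat -> nat ;
  residue_compat : forall n, (residue n.+1 %% p ^ n)%N = residue n }.

Section PadicZ.
Variables (p : nat) (p_pr : prime p).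
Local Notation Zp := (padicZ p_pr).
Implicit Types x y z : Zp.

HB.instance Definition _ := gen_eqMixin Zp.
HB.instance Definition _ := gen_choiceMixin Zp.

Lemma padicZ_eq x y : residue x =1 residue y -> x = y.
Proof.
case: x y => [f hf] [g hg] /= /funext efg.
by move: hg; rewrite -efg => hg; rewrite (Prop_irrelevance hf hg).
Qed.

Lemma residue_mod x n : (residue x n %% p ^ n)%N = residue x n.
Proof. by rewrite -{1}residue_compat modn_mod residue_compat. Qed.

Lemma residue_le x m n : (m <= n)%N -> (residue x n %% p ^ m)%N = residue x m.
Proof.
move=> /subnK <-; elim: (n - m)%N => [|k IH]; first exact: residue_mod.
by rewrite addSn -IH -(residue_compat _ (k + m)) modn_dvdm // dvdn_exp2l // leq_addl.
Qed.

Fact padicZ_mk_subproof (f : nat -> nat) :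
  (forall n, f n.+1 = f n %[mod p ^ n]) ->
  forall n, ((f n.+1 %% p ^ n.+1) %% p ^ n)%N = (f n %% p ^ n)%N.
Proof. by move=> hf n; rewrite modn_dvdm ?hf // expnS dvdn_mull. Qed.

Definition padicZ_mk f hf : Zp := PadicZ p_pr (@padicZ_mk_subproof f hf).

Fact padicZ_nat_subproof (a n : nat) : a = a %[mod p ^ n]. Proof. by []. Qed.

Fact padicZ_add_subproof x y n :
  residue x n.+1 + residue y n.+1 = residue x n + residue y n %[mod p ^ n].
Proof. by rewrite -modnDm !residue_compat. Qed.

Fact padicZ_mul_subproof x y n :
  residue x n.+1 * residue y n.+1 = residue x n * residue y n %[mod p ^ n].
Proof. by rewrite -modnMm !residue_compat. Qed.

Fact padicZ_opp_subproof x n :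
  (p ^ n.+1).-1 * residue x n.+1 = (p ^ n).-1 * residue x n %[mod p ^ n].
Proof.
have pn_gt0 m : (0 < p ^ m)%N by rewrite expn_gt0 prime_gt0.
rewrite -[in RHS]residue_compat modnMmr.
apply/eqP; rewrite -(eqn_modDr (residue x n.+1)) -!mulSnr !prednK //.
by rewrite expnS -mulnA mulnCA !modnMr.
Qed.

Definition padicZ_nat (a : nat) : Zp := padicZ_mk (padicZ_nat_subproof a).
Definition padicZ_add x y : Zp := padicZ_mk (padicZ_add_subproof x y).
Definition padicZ_mul x y : Zp := padicZ_mk (padicZ_mul_subproof x y).
(* -x is represented by (p^n - 1) x modulo p^n *)
Definition padicZ_opp x : Zp := padicZ_mk (padicZ_opp_subproof x).

Fact padicZ_addA : associative padicZ_add.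
Proof. by move=> x y z; apply: padicZ_eq => n /=; rewrite modnDml modnDmr addnA. Qed.

Fact padicZ_addC : commutative padicZ_add.
Proof. by move=> x y; apply: padicZ_eq => n /=; rewrite addnC. Qed.

Fact padicZ_add0 : left_id (padicZ_nat 0) padicZ_add.
Proof. by move=> x; apply: padicZ_eq => n /=; rewrite modnDml residue_mod. Qed.

Fact padicZ_addN : left_inverse (padicZ_nat 0) padicZ_opp padicZ_add.
Proof.
move=> x; apply: padicZ_eq => n /=; rewrite modnDml -mulSnr prednK.
  by rewrite modnMr mod0n.
by rewrite expn_gt0 prime_gt0.
Qed.

HB.instance Definition _ :=
  GRing.isZmodule.Build Zp padicZ_addA padicZ_addC padicZ_add0 padicZ_addN.

Fact padicZ_mulA : associative padicZ_mul.
Proof. by move=> x y z; apply: padicZ_eq => n /=; rewrite modnMml modnMmr mulnA. Qed.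

Fact padicZ_mulC : commutative padicZ_mul.
Proof. by move=> x y; apply: padicZ_eq => n /=; rewrite mulnC. Qed.

Fact padicZ_mul1 : left_id (padicZ_nat 1) padicZ_mul.
Proof. by move=> x; apply: padicZ_eq => n /=; rewrite modnMml mul1n residue_mod. Qed.

Fact padicZ_mulDl : left_distributive padicZ_mul padicZ_add.
Proof.
by move=> x y z; apply: padicZ_eq => n /=; rewrite modnMml modnDm mulnDl.
Qed.

Fact padicZ_1neq0 : padicZ_nat 1 != 0.
Proof.
apply/eqP => /(congr1 (@residue _ _))/(congr1 (@^~ 1%N)) /=.
by rewrite expn1 mod0n modn_small // prime_gt1.
Qed.

HB.instance Definition _ := GRing.Zmodule_isComNzRing.Build Zp
  padicZ_mulA padicZ_mulC padicZ_mul1 padicZ_mulDl padicZ_1neq0.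

Definition padicZ_unit : pred Zp := fun x => `[< exists y, y * x = 1 >].
Definition padicZ_inv x : Zp := xget x [set y | y * x = 1].

Fact padicZ_mulV : {in padicZ_unit, left_inverse 1 padicZ_inv *%R}.
Proof.
move=> x; rewrite -topredE /= => /asboolP xu.
by rewrite /padicZ_inv; case: xgetP => [y -> //|none]; case: xu => y /none.
Qed.

Fact padicZ_unitP x y : y * x = 1 -> padicZ_unit x.
Proof. by move=> xy; apply/asboolP; exists y. Qed.

Fact padicZ_inv_out : {in [predC padicZ_unit], padicZ_inv =1 id}.
Proof.
move=> x; rewrite inE /= -topredE /= => /asboolPn xu.
by rewrite /padicZ_inv; case: xgetP => // y _ yx; case: xu; exists y.
Qed.

HB.instance Definition _ := GRing.ComNzRing_hasMulInverse.Build Zp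
  padicZ_mulV padicZ_unitP padicZ_inv_out.

Lemma padicZ_neq0P x : x != 0 -> exists n, residue x n != 0%N.
Proof.
move=> x0; apply: contrapT => none; move/eqP: x0; apply.
apply: padicZ_eq => n; rewrite /= mod0n.
by apply/eqP; apply: contrapT => /negP xn; apply: none; exists n.
Qed.

(* the order of vanishing at p; the value at 0 is never used *)
Definition padicZ_val x : nat :=
  xget 0%N [set n | residue x n = 0%N /\ residue x n.+1 <> 0%N].

Lemma residue0_le x m n : (m <= n)%N -> residue x n = 0%N -> residue x m = 0%N.
Proof. by move=> /(residue_le x) <- ->; rewrite mod0n. Qed.

Lemma padicZ_valP x n : x != 0 -> (residue x n == 0%N) = (n <= padicZ_val x)%N.
Proof.
move=> x0.
have [v xv0 xv1] : exists2 v, residue x v = 0%N & residue x v.+1 <> 0%N.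
  have ex := padicZ_neq0P x0.
  case: (ex_minnP ex) => -[|m] xm mmin.
    by move: xm; rewrite -residue_mod expn0 modn1.
  exists m; last exact/eqP.
  by apply/eqP; apply: contraT => /mmin; rewrite ltnn.
have [xw0 xw1] : [set n | residue x n = 0%N /\ residue x n.+1 <> 0%N] (padicZ_val x).
  by rewrite /padicZ_val; case: xgetP => [w -> //|/(_ v)/(_ (conj xv0 xv1))].
apply/eqP/idP => [xn|/residue0_le]; last exact.
by rewrite leqNgt; apply/negP => /residue0_le /(_ xn).
Qed.

Lemma residueM0 x y m : x != 0 -> y != 0 ->
  (residue (x * y) m == 0%N) = (m <= padicZ_val x + padicZ_val y)%N.
Proof.
move=> x0 y0; set M := (m + (padicZ_val x + padicZ_val y).+1)%N.
have key z : z != 0 -> (padicZ_val z < M)%N ->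
    (residue z M != 0%N) /\ logn p (residue z M) = padicZ_val z.
  move=> z0 zM; have zn0 : residue z M != 0%N by rewrite padicZ_valP // -ltnNge.
  split=> //; apply/eqP; rewrite eqn_leq; apply/andP; split.
    rewrite leqNgt; apply/negP => lt.
    have /eqP : residue z (padicZ_val z).+1 = 0%N.
      rewrite -(residue_le z zM); apply/eqP; rewrite -/(dvdn _ _).
      by rewrite pfactor_dvdn // lt0n.
    by rewrite padicZ_valP // ltnn.
  rewrite -pfactor_dvdn ?lt0n // /dvdn (residue_le z (ltnW zM)).
  by rewrite padicZ_valP.
have [x1 xl] : (residue x M != 0%N) /\ logn p (residue x M) = padicZ_val x.
  by apply: key => //; rewrite /M addnS ltnS addnA -addnA addnCA leq_addr.
have [y1 yl] : (residue y M != 0%N) /\ logn p (residue y M) = padicZ_val y.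
  by apply: key => //; rewrite /M addnS ltnS addnA leq_addl.
have mM : (m <= M)%N by rewrite leq_addr.
rewrite -(residue_le (x * y) mM) /= modn_dvdm ?dvdn_exp2l // -/(dvdn _ _).
by rewrite pfactor_dvdn ?muln_gt0 ?lt0n ?x1 // lognM ?lt0n // xl yl.
Qed.

Fact padicZ_integral x y : x * y = 0 -> (x == 0) || (y == 0).
Proof.
move=> xy0; apply: contraT; rewrite negb_or => /andP[x0 y0].
have := residueM0 (padicZ_val x + padicZ_val y).+1 x0 y0.
by rewrite xy0 /= mod0n eqxx ltnn.
Qed.

HB.instance Definition _ :=
  GRing.ComUnitRing_isIntegral.Build Zp padicZ_integral.

End PadicZ.

(* The real numbers R only serve to carry the values of the absolute value, and
   hence the topology. *)
Definition padicQ (R : realType) (p : nat) (p_pr : prime p) : Type :=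
  {fraction padicZ p_pr}.

HB.instance Definition _ (R : realType) (p : nat) (p_pr : prime p) :=
  GRing.Field.on (padicQ R p_pr).

Section PadicAbs.
Variables (R : realType) (p : nat) (p_pr : prime p).
Local Notation Zp := (padicZ p_pr).
Local Notation Qp := (padicQ R p_pr).

Definition padicZ_abs (x : Zp) : R :=
  if x == 0 then 0 else (p%:R ^+ padicZ_val x)^-1.

Definition padic_abs (x : Qp) : R :=
  padicZ_abs (frac (repr x)).1 / padicZ_abs (frac (repr x)).2.

Let p_gt0 : 0 < p%:R :> R. Proof. by rewrite ltr0n prime_gt0. Qed.

Lemma padicZ_abs0 : padicZ_abs 0 = 0. Proof. by rewrite /padicZ_abs eqxx. Qed.

Lemma padicZ_abs_ge0 x : 0 <= padicZ_abs x.
Proof.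
by rewrite /padicZ_abs; case: ifP => // _; rewrite invr_ge0 exprn_ge0 ?ltW.
Qed.

Lemma padicZ_abs_eq0 x : (padicZ_abs x == 0) = (x == 0).
Proof.
rewrite /padicZ_abs; case: ifP => x0; first by rewrite eqxx.
by apply/negbTE; rewrite invr_eq0 expf_neq0 // lt0r_neq0.
Qed.

Lemma padicZ_absM x y : padicZ_abs (x * y) = padicZ_abs x * padicZ_abs y.
Proof.
have [->|x0] := eqVneq x 0; first by rewrite mul0r padicZ_abs0 mul0r.
have [->|y0] := eqVneq y 0; first by rewrite mulr0 padicZ_abs0 mulr0.
have xy0 : x * y != 0 by rewrite mulf_neq0.
have -> : padicZ_abs (x * y) = (p%:R ^+ padicZ_val (x * y))^-1.
  by rewrite /padicZ_abs (negbTE xy0).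
have -> : padicZ_val (x * y) = (padicZ_val x + padicZ_val y)%N.
  apply/eqP; rewrite eqn_leq -residueM0 // padicZ_valP // leqnn /=.
  by rewrite -padicZ_valP // residueM0.
by rewrite /padicZ_abs (negbTE x0) (negbTE y0) exprD invfM.
Qed.

Lemma padicZ_abs_le x n : (padicZ_abs x <= (p%:R ^+ n)^-1) = (residue x n == 0%N).
Proof.
rewrite /padicZ_abs; have [->|x0] := eqVneq x 0.
  by rewrite invr_ge0 exprn_ge0 ?ltW //= mod0n eqxx.
rewrite lef_pV2 ?posrE ?exprn_gt0 // ler_eXn2l ?padicZ_valP //.
by rewrite ltr1n prime_gt1.
Qed.

Lemma padicZ_absN x : padicZ_abs (- x) = padicZ_abs x.
Proof.
have abs1 : padicZ_abs (-1) = 1.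
  apply/eqP; rewrite -sqrp_eq1 ?padicZ_abs_ge0 // expr2 -padicZ_absM mulrNN mulr1.
  have abs1_neq0 : padicZ_abs 1 != 0 by rewrite padicZ_abs_eq0 oner_neq0.
  by apply/eqP/(mulIf abs1_neq0); rewrite -padicZ_absM !mul1r.
by rewrite -mulN1r padicZ_absM abs1 mul1r.
Qed.

Lemma padicZ_absD x y : padicZ_abs (x + y) <= padicZ_abs x + padicZ_abs y.
Proof.
have [->|x0] := eqVneq x 0; first by rewrite add0r padicZ_abs0 add0r.
have [->|y0] := eqVneq y 0; first by rewrite addr0 padicZ_abs0 addr0.
wlog xy : x y x0 y0 / (padicZ_val x <= padicZ_val y)%N => [hw|].
  by have /orP[|] := leq_total (padicZ_val x) (padicZ_val y) => /hw;
    last rewrite addrC (addrC (padicZ_abs _)); apply.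
apply: (@le_trans _ _ (padicZ_abs x)); last by rewrite lerDl padicZ_abs_ge0.
rewrite {2}/padicZ_abs (negbTE x0) padicZ_abs_le /=.
have /eqP -> : residue x (padicZ_val x) == 0%N by rewrite padicZ_valP.
have /eqP -> : residue y (padicZ_val x) == 0%N by rewrite padicZ_valP.
by rewrite addn0 mod0n.
Qed.

Local Notation "x %:F" := (FracField.tofrac x).

Lemma fraction_repr (x : {fraction Zp}) :
  x = (frac (repr x)).1%:F / (frac (repr x)).2%:F.
Proof.
have d0 := denom_ratioP (repr x).
rewrite -[LHS]reprK -[in LHS](Ratio_numden (repr x)).
rewrite !piE; apply/eqmodP => /=.
rewrite /FracField.mulf /FracField.invf !numden_Ratio ?oner_neq0 //.
  by rewrite mul1r mulr1 FracField.equivfE !numden_Ratio // mulrC.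
Qed.

Lemma padic_abs_frac (a b : Zp) : b != 0 ->
  padic_abs (a%:F / b%:F) = padicZ_abs a / padicZ_abs b.
Proof.
move=> b0; rewrite /padic_abs; set r := repr _.
have d0 : (frac r).2 != 0 := denom_ratioP r.
have := fraction_repr (a%:F / b%:F); rewrite -/r => /eqP.
rewrite eqr_div ?tofrac_eq0 // -!tofracM tofrac_eq => /eqP e.
apply/eqP; rewrite eqr_div ?padicZ_abs_eq0 // -!padicZ_absM -e.
by rewrite mulrC.
Qed.

Lemma padic_abs0 : padic_abs 0 = 0.
Proof.
have := @padic_abs_frac 0 1 (oner_neq0 _).
by rewrite tofrac0 mul0r padicZ_abs0 mul0r.
Qed.

Lemma padic_absN x : padic_abs (- x) = padic_abs x.
Proof.
rewrite (fraction_repr x) -mulNr -tofracN !padic_abs_frac ?denom_ratioP //.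
by rewrite padicZ_absN.
Qed.

Lemma padic_absD x y : padic_abs (x + y) <= padic_abs x + padic_abs y.
Proof.
rewrite (fraction_repr x) (fraction_repr y).
have b0 := denom_ratioP (repr x); have d0 := denom_ratioP (repr y).
move: (frac (repr x)).1 (frac (repr x)).2 b0 => a b b0.
move: (frac (repr y)).1 (frac (repr y)).2 d0 => c d d0.
rewrite addf_div ?tofrac_eq0 // -!tofracM -tofracD.
rewrite !padic_abs_frac ?mulf_neq0 // addf_div ?padicZ_abs_eq0 // -!padicZ_absM.
by rewrite ler_wpM2r ?invr_ge0 ?padicZ_abs_ge0 // padicZ_absD.
Qed.

Definition padic_ball (x : Qp) (e : R) : set Qp :=
  [set y | padic_abs (x - y) < e].

Fact padic_ball_center x (e : R) : 0 < e -> padic_ball x e x.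
Proof. by rewrite /padic_ball /= subrr padic_abs0. Qed.

Fact padic_ball_sym x y (e : R) : padic_ball x e y -> padic_ball y e x.
Proof. by rewrite /padic_ball /= -opprB padic_absN. Qed.

Fact padic_ball_triangle x y z (e1 e2 : R) :
  padic_ball x e1 y -> padic_ball y e2 z -> padic_ball x (e1 + e2) z.
Proof.
rewrite /padic_ball /= => xy yz.
have -> : x - z = (x - y) + (y - z) by rewrite addrA subrK.
by apply: le_lt_trans (padic_absD _ _) _; rewrite ltrD.
Qed.

HB.instance Definition _ := isPointed.Build Qp 0.
HB.instance Definition _ := hasNbhs.Build Qp (nbhs_ball_ padic_ball).

Fact padic_nbhsE : nbhs = nbhs_ (entourage_ padic_ball) :> (Qp -> _).
Proof.
apply/funext => x; apply/seteqP; split => A.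
  move=> [e e0 eA]; exists [set xy | padic_ball xy.1 e xy.2]; first by exists e.
  by move=> y /xsectionP /eA.
move=> [E [e e0 eE] EA]; exists e => // y xy; apply: EA; apply/xsectionP.
exact: eE.
Qed.

HB.instance Definition _ := Nbhs_isPseudoMetric.Build R Qp
  padic_nbhsE padic_ball_center padic_ball_sym padic_ball_triangle erefl.

End PadicAbs.

Section Analysis.
Variables (R : realType) (p : nat) (p_pr : prime p) (n : nat).
Local Notation C := R[i].
Local Notation Qp := (padicQ R p_pr).
Local Notation Qpn := 'rV[Qp]_n.

Definition padic_borel := g_sigma_algebraType (@open Qpn).

Definition normalized_haar (mu : {measure set padic_borel -> \bar R}) : Prop :=
  mu [set x : Qpn | forall i, padic_abs (x 0 i) <= 1] = 1%E /\
  forall (a : Qpn) (A : set padic_borel), measurable A ->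
    mu [set (a + x : Qpn) | x in (A : set Qpn)] = mu A.

(* The p-adic fractional part: the class of x in Q_p/Z_p corresponds to the
   class in Q/Z of a unique rational r = a/p^k with 0 <= r < 1. *)
Definition padic_frac (x : Qp) : R :=
  xget 0 [set r | exists a k : nat, [/\ (a < p ^ k)%N,
    r = a%:R / p%:R ^+ k & padic_abs (x - a%:R / p%:R ^+ k) <= 1]].

Definition padic_char (x : Qp) : C :=
  (cos (2 * pi * padic_frac x) +i* sin (2 * pi * padic_frac x))%C.

Definition padic_dot (x y : Qpn) : Qp := \sum_i x 0 i * y 0 i.

Definition schwartz_bruhat (phi : Qpn -> C) : Prop :=
  (forall x, \forall y \near x, phi y = phi x) /\
  compact (closure [set x | phi x != 0]).

Definition quasielliptic (f : mpoly.mpoly n Qp) (d : nat) (w : 'I_n -> nat) :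
    Prop :=
  [/\ forall c, f <> mpoly.mpolyC n c,
      forall i, (0 < w i)%N,
      forall (l : Qp) (xi : 'I_n -> Qp), l != 0 ->
        mpoly.meval (fun i => l ^+ w i * xi i) f = l ^+ d * mpoly.meval xi f &
      forall xi : 'I_n -> Qp, mpoly.meval xi f = 0 <-> forall i, xi i = 0].

Definition padic_integral_coeffs (f : mpoly.mpoly n Qp) : Prop :=
  forall m, padic_abs (mpoly.mcoeff m f) <= 1.

Definition quasi_norm (d : nat) (w : 'I_n -> nat) (xi : Qpn) : R :=
  \sum_i padic_abs (xi 0 i) `^ (d%:R / (w i)%:R).

Variable mu : {measure set padic_borel -> \bar R}.

Definition Cintegral (g : Qpn -> C) : C :=
  ((\int[mu]_x complex.Re (g x)) +i* (\int[mu]_x complex.Im (g x)))%C.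

Definition fourier (phi : Qpn -> C) : Qpn -> C :=
  fun xi => Cintegral (fun x => padic_char (- padic_dot x xi) * phi x).

(* the inverse of the bijection induced by the Fourier transform on the
   Schwartz-Bruhat space *)
Definition inverse_fourier (g : Qpn -> C) : Qpn -> C :=
  xget 0 [set psi | schwartz_bruhat psi /\ fourier psi = g].

Definition sobolev_norm (d : nat) (w : 'I_n -> nat) (beta : R)
    (phi : Qpn -> C) : R :=
  Num.sqrt (\int[mu]_xi
    (quasi_norm d w xi `^ (2 * beta) * Normc.normc (fourier phi xi) ^+ 2)).

Definition lizorkin : set (Qpn -> C) :=
  [set phi | schwartz_bruhat phi /\ fourier phi 0 = 0].

Definition pseudodiff (f : mpoly.mpoly n Qp) (alpha : R) (phi : Qpn -> C) :
    Qpn -> C :=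
  inverse_fourier (fun xi =>
    (padic_abs (mpoly.meval (fun i => xi 0 i) f) `^ alpha)%:C%C * fourier phi xi).

End Analysis.

Section Completion.
Variables (R : realType) (E : lmodType R[i]) (D : set E).

(* H, together with iota, is the completion of the linear subspace D of E for
   the norm N; the values of iota outside D are irrelevant. *)
Record is_completion (N : E -> R) (H : completeNormedModType R[i])
    (iota : E -> H) : Prop := IsCompletion {
  completion_linear : forall (a : R[i]) u v, D u -> D v ->
    iota (a *: u + v) = a *: iota u + iota v ;
  completion_isometry : forall u, D u -> `|iota u| = (N u)%:C%C ;
  completion_dense : dense (iota @` D) }.

Variables (H K : completeNormedModType R[i]) (iotaH : E -> H) (iotaK : E -> K).

Definition extension_by_density (A : E -> E) (T : {linear H -> K}) : Prop :=
  continuous T /\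
  forall u, D u -> D (A u) /\ T (iotaH u) = iotaK (A u).

Definition bicontinuous_isomorphism (T : {linear H -> K}) : Prop :=
  continuous T /\
  exists S : {linear K -> H}, [/\ cancel T S, cancel S T & continuous S].

End Completion.

(* Main.v *)
(** The operator is multiplication by |f|^alpha on the Fourier side.  Scaling by
    (l^w_1, ..., l^w_n) moves every nonzero point into a compact shell on which f
    does not vanish, whence c1 Xi <= |f| <= c2 Xi off the origin, and |f| is locally
    constant there.  So multiplication by |f|^(+-alpha) preserves the
    Schwartz-Bruhat functions vanishing at 0, and distorts the two Sobolev norms
    by bounded factors only.  As the Fourier transform maps the Schwartz-Bruhat
    space onto itself, the relation "Fv = |f|^alpha Fu" on the Lizorkin space is
    linear, bounded in both directions, and has both projections full.  The closure
    of its image in the product of the two completions is then the graph of the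
    required isomorphism; this treats the operator and its inverse symmetrically
    and never uses injectivity of the Fourier transform. *)

Require Import Defs.
From HB Require Import structures.
From mathcomp Require Import all_boot all_order all_algebra fraction.
From mathcomp Require Import complex.
From mathcomp Require Import all_classical all_reals all_analysis.
From mathcomp Require mpoly.
From mathcomp Require Import ring lra.

Set Implicit Arguments.
Unset Strict Implicit.
Unset Printing Implicit Defensive.

Import Order.TTheory GRing.Theory Num.Theory.
Import numFieldNormedType.Exports.

Local Open Scope classical_set_scope.
Local Open Scope ring_scope.

(** * The p-adic absolute value *)

(** Two features of the definitions shape the proof. Real integrals are total, so norms can be
    compared only after both integrands are known to be integrable; this is where [alpha <= beta]
    enters, a nonnegative power of Xi being bounded on the compact support of a transform. And
    [inverse_fourier] chooses some preimage, so a value of the operator is known through its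
    transform alone; functions with equal transforms differ by an element of norm 0, hence have the
    same image in each completion, and the norm bounds make the closed graph single-valued in both
    directions. The facts on the Fourier transform come from translation invariance and vol(Z_p^n) =
    1: translating by a vector on which the character is not 1 makes an integral vanish, and a
    Schwartz-Bruhat function is a finite combination of coset indicators with explicit preimages.
    The delicate point is the origin, where |f|^s need not be locally constant. Transforms of
    Lizorkin functions vanish there, which makes negative exponents admissible too. *)

Section PadicField.
Variables (R : realType) (p : nat) (p_pr : prime p).
Local Notation Zp := (padicZ p_pr).
Local Notation Qp := (padicQ R p_pr).
Local Notation "x %:F" := (FracField.tofrac x : Qp).
Implicit Types (x y : Qp) (a b : Zp).

Lemma padic_frac_ex x : exists a b, b != 0 /\ x = a%:F / b%:F.
Proof.
exists (frac (repr x)).1, (frac (repr x)).2; split; first exact: denom_ratioP.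
exact: fraction_repr.
Qed.

Lemma padic_abs_tofrac a : padic_abs (a%:F) = padicZ_abs R a.
Proof.
have := @padic_abs_frac R p p_pr a 1 (oner_neq0 _).
rewrite tofrac1 divr1 => ->.
have abs1 : padicZ_abs R (1 : Zp) = 1.
  have n0 : padicZ_abs R (1 : Zp) != 0 by rewrite padicZ_abs_eq0 oner_neq0.
  by apply/(mulIf n0); rewrite -padicZ_absM !mul1r.
by rewrite abs1 divr1.
Qed.

Lemma padic_absM x y : padic_abs (x * y) = padic_abs x * padic_abs y.
Proof.
have [a [b [b0 ->]]] := padic_frac_ex x; have [c [e [e0 ->]]] := padic_frac_ex y.
rewrite mulf_div -!tofracM !padic_abs_frac ?mulf_neq0 // !padicZ_absM.
by rewrite mulf_div.
Qed.

Lemma padic_abs_ge0 x : 0 <= padic_abs x.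
Proof.
have [a [b [b0 ->]]] := padic_frac_ex x.
by rewrite padic_abs_frac // divr_ge0 ?padicZ_abs_ge0.
Qed.

Lemma padic_abs_eq0 x : (padic_abs x == 0) = (x == 0).
Proof.
have [a [b [b0 ->]]] := padic_frac_ex x.
rewrite padic_abs_frac // !mulf_eq0 !invr_eq0 !padicZ_abs_eq0.
by rewrite !tofrac_eq0.
Qed.

Lemma padic_abs_gt0 x : (0 < padic_abs x) = (x != 0).
Proof. by rewrite lt_def padic_abs_eq0 padic_abs_ge0 andbT. Qed.

Lemma padic_abs1 : padic_abs (1 : Qp) = 1.
Proof.
have n0 : padic_abs (1 : Qp) != 0 by rewrite padic_abs_eq0 oner_neq0.
by apply/(mulIf n0); rewrite -padic_absM !mul1r.
Qed.

Lemma padic_absV x : padic_abs x^-1 = (padic_abs x)^-1.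
Proof.
have [->|x0] := eqVneq x 0; first by rewrite invr0 padic_abs0 invr0.
have n0 : padic_abs x != 0 by rewrite padic_abs_eq0.
by apply: (mulIf n0); rewrite -padic_absM !mulVf // padic_abs1.
Qed.

Lemma padic_absX x k : padic_abs (x ^+ k) = padic_abs x ^+ k.
Proof.
by elim: k => [|k IH]; rewrite ?expr0 ?padic_abs1 // !exprS padic_absM IH.
Qed.

(** Both residues vanish modulo p^v for the smaller valuation v, hence so does that of the sum. An
    arbitrary bound [e] in place of a maximum lets the estimate iterate over finite sums. *)
Lemma padicZ_absD_le a b (e : R) : padicZ_abs R a <= e -> padicZ_abs R b <= e ->
  padicZ_abs R (a + b) <= e.
Proof.
move=> ae be.
have [->|a0] := eqVneq a 0; first by rewrite add0r.
have [->|b0] := eqVneq b 0; first by rewrite addr0.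
have key (x y : Zp) : x != 0 -> y != 0 -> (padicZ_val x <= padicZ_val y)%N ->
    padicZ_abs R (x + y) <= padicZ_abs R x.
  move=> x0 y0 xy; rewrite {2}/padicZ_abs (negbTE x0) padicZ_abs_le /=.
  have /eqP -> : residue x (padicZ_val x) == 0%N by rewrite padicZ_valP.
  have /eqP -> : residue y (padicZ_val x) == 0%N by rewrite padicZ_valP.
  by rewrite addn0 mod0n.
have /orP[ab|ba] := leq_total (padicZ_val a) (padicZ_val b).
  exact: le_trans (key _ _ a0 b0 ab) ae.
by rewrite addrC; apply: le_trans (key _ _ b0 a0 ba) be.
Qed.

Lemma padic_absD_le x y (e : R) : padic_abs x <= e -> padic_abs y <= e ->
  padic_abs (x + y) <= e.
Proof.
have [a [b [b0 ->]]] := padic_frac_ex x; have [c [h [h0 ->]]] := padic_frac_ex y.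
rewrite addf_div ?tofrac_eq0 // -!tofracM -tofracD.
rewrite !padic_abs_frac ?mulf_neq0 //.
have ab : 0 < padicZ_abs R b by rewrite lt_def padicZ_abs_eq0 b0 padicZ_abs_ge0.
have ah : 0 < padicZ_abs R h by rewrite lt_def padicZ_abs_eq0 h0 padicZ_abs_ge0.
rewrite !ler_pdivrMr // ?padicZ_absM ?mulr_gt0 // => xe ye.
apply: padicZ_absD_le; rewrite padicZ_absM.
  by rewrite mulrA ler_wpM2r // ltW.
by rewrite [padicZ_abs R b * _]mulrC mulrA ler_wpM2r // ltW.
Qed.

Lemma padic_absB_le x y (e : R) : padic_abs x <= e -> padic_abs y <= e ->
  padic_abs (x - y) <= e.
Proof. by move=> xe ye; apply: padic_absD_le; rewrite ?padic_absN. Qed.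

Lemma padic_abs_distC x y : padic_abs (x - y) = padic_abs (y - x).
Proof. by rewrite -opprB padic_absN. Qed.

(** The isosceles property of an ultrametric. It turns approximations into equalities of absolute
    values, and is the source of the local constancy of |f|. *)
Lemma padic_abs_eq_of_lt x y : padic_abs (x - y) < padic_abs x ->
  padic_abs y = padic_abs x.
Proof.
move=> xy; apply/eqP; rewrite eq_le; apply/andP; split.
  rewrite -[y](subKr x); apply: padic_absB_le => //; exact: ltW.
rewrite leNgt; apply/negP => yx.
have : padic_abs x <= Num.max (padic_abs (x - y)) (padic_abs y).
  by rewrite -{1}[x](subrK y); apply: padic_absD_le; rewrite le_max lexx ?orbT.
by rewrite le_max !leNgt xy yx.
Qed.

Lemma padic_abs_sum_le (I : Type) (r : seq I) (P : pred I) (F : I -> Qp) (e : R) :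
  0 <= e -> (forall i, P i -> padic_abs (F i) <= e) ->
  padic_abs (\sum_(i <- r | P i) F i) <= e.
Proof.
move=> e0 Fe; elim/big_ind: _ => //; first by rewrite padic_abs0.
by move=> x y; apply: padic_absD_le.
Qed.

Let p_gt0 : 0 < p%:R :> R. Proof. by rewrite ltr0n prime_gt0. Qed.
Let p_gt1 : 1 < p%:R :> R. Proof. by rewrite ltr1n prime_gt1. Qed.

Lemma residue_nat (k m : nat) : residue (k%:R : Zp) m = (k %% p ^ m)%N.
Proof.
elim: k => [|k IH]; first by rewrite /= mod0n.
by rewrite -addn1 natrD /= IH modnDml modnDmr.
Qed.

Lemma padic_abs_nat_le (k m : nat) :
  (padic_abs (k%:R : Qp) <= (p%:R ^+ m)^-1) = (p ^ m %| k)%N.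
Proof.
have -> : (k%:R : Qp) = (k%:R : Zp)%:F by rewrite rmorph_nat.
by rewrite padic_abs_tofrac padicZ_abs_le residue_nat.
Qed.

Lemma exp_pV_le m k : (m <= k)%N -> (p%:R ^+ k)^-1 <= (p%:R ^+ m)^-1 :> R.
Proof. by move=> mk; rewrite lef_pV2 ?posrE ?exprn_gt0 // ler_eXn2l. Qed.

Lemma exp_pV_le1 k : (p%:R ^+ k)^-1 <= 1 :> R.
Proof. by have := exp_pV_le (leq0n k); rewrite expr0 invr1. Qed.

Lemma exp_p_ge1 k : 1 <= p%:R ^+ k :> R.
Proof. by rewrite exprn_ege1 // ltW. Qed.

Lemma exp_pV_le_exp k m : (p%:R ^+ k)^-1 <= p%:R ^+ m :> R.
Proof. exact: le_trans (exp_pV_le1 k) (exp_p_ge1 m). Qed.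

Lemma padic_abs_nat_le1 k : padic_abs (k%:R : Qp) <= 1.
Proof. by have := padic_abs_nat_le k 0; rewrite expr0 invr1 expn0 dvd1n. Qed.

Lemma padic_abs_p : padic_abs (p%:R : Qp) = p%:R^-1.
Proof.
have le1 : padic_abs (p%:R : Qp) <= p%:R^-1.
  by have := padic_abs_nat_le p 1; rewrite expr1 expn1 dvdnn.
apply/eqP; rewrite eq_le le1 /=.
(* Were p zero in [Qp], its absolute value would be at most p^-2, and p^2 would divide p. *)
have p0 : (p%:R : Qp) != 0.
  rewrite -padic_abs_eq0; apply/negP => /eqP h.
  have := padic_abs_nat_le p 2; rewrite h invr_ge0 exprn_ge0 ?ltW //.
  move/esym; rewrite expnS expn1 => /dvdn_leq; rewrite prime_gt0 // => /(_ isT).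
  by rewrite leqNgt -{1}[p]muln1 ltn_mul2l prime_gt0 ?prime_gt1.
have pz : (p%:R : Zp) != 0.
  by move: p0; rewrite -(rmorph_nat (FracField.tofrac (R := Zp))) tofrac_eq0.
have -> : (p%:R : Qp) = (p%:R : Zp)%:F by rewrite rmorph_nat.
rewrite padic_abs_tofrac /padicZ_abs (negbTE pz).
rewrite lef_pV2 ?posrE ?exprn_gt0 // -[leRHS]expr1 ler_eXn2l //.
rewrite -ltnS ltnNge -padicZ_valP // residue_nat modn_small.
  by rewrite -lt0n prime_gt0.
by rewrite -{1}[p]expn1 ltn_exp2l ?prime_gt1.
Qed.

Lemma padic_p_neq0 : (p%:R : Qp) != 0.
Proof. by rewrite -padic_abs_eq0 padic_abs_p invr_eq0 gt_eqF. Qed.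

Lemma padic_pX_neq0 k : (p%:R ^+ k : Qp) != 0.
Proof. by rewrite expf_neq0 // padic_p_neq0. Qed.

Lemma padic_abs_pX k : padic_abs (p%:R ^+ k : Qp) = (p%:R ^+ k)^-1.
Proof. by rewrite padic_absX padic_abs_p exprVn. Qed.

Lemma padic_abs_disc x : x != 0 ->
  exists k l : nat, padic_abs x = p%:R ^+ k / p%:R ^+ l.
Proof.
have [a [b [b0 ->]]] := padic_frac_ex x => ab0.
have a0 : a != 0 by apply: contra ab0 => /eqP ->; rewrite tofrac0 mul0r.
exists (padicZ_val b), (padicZ_val a).
by rewrite padic_abs_frac // /padicZ_abs (negbTE a0) (negbTE b0) invrK mulrC.
Qed.

(** Write [x] as a / b. Since |x| <= 1, the power p^v in [b] also divides [a]; after cancelling it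
    the denominator is a unit modulo p^m, and [c] is the quotient of the two residues. *)
Lemma padic_approx x m : padic_abs x <= 1 ->
  exists2 c : nat, (c < p ^ m)%N & padic_abs (x - c%:R) <= (p%:R ^+ m)^-1.
Proof.
have [a [b [b0 ->]]] := padic_frac_ex x; rewrite padic_abs_frac //.
have ab : 0 < padicZ_abs R b by rewrite lt_def padicZ_abs_eq0 b0 padicZ_abs_ge0.
rewrite ler_pdivrMr // mul1r => h.
(* Cancelling p^v costs [v] digits, so the residues are taken modulo p^(m + v). *)
pose v := padicZ_val b; pose M := (m + v)%N.
have bv : residue b v = 0%N by apply/eqP; rewrite padicZ_valP.
have bv1 : residue b v.+1 != 0%N by rewrite padicZ_valP // ltnn.
have av : residue a v = 0%N.
  apply/eqP; rewrite -(padicZ_abs_le R); apply: le_trans h _.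
  by rewrite /padicZ_abs (negbTE b0).
have pv0 : (0 < p ^ v)%N by rewrite expn_gt0 prime_gt0.
have vM : (v <= M)%N by rewrite leq_addl.
have /dvdnP[a' ea] : (p ^ v %| residue a M)%N by rewrite /dvdn residue_le ?av.
have [m0|m0] := posnP m.
  exists 0%N; first by rewrite m0.
  rewrite m0 expr0 invr1 subr0 padic_abs_frac // ler_pdivrMr // mul1r //.
have v1M : (v.+1 <= M)%N by rewrite /M -addn1 addnC leq_add2r.
have /dvdnP[b' eb] : (p ^ v %| residue b M)%N by rewrite /dvdn residue_le ?bv.
have cb : coprime b' (p ^ m).
  rewrite coprimeXr // coprime_sym prime_coprime //; apply/negP => /dvdnP[q qb].
  move: bv1; rewrite -(residue_le b v1M) eb qb -mulnA -expnS modnMl //.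
(* By Bezout, [u] is the inverse of [b'] modulo p^m. *)
have [u [u' eu]] : exists u u', (u * b' = u' * p ^ m + 1)%N.
  case: b' cb {eb} => [|b'] cb.
    have : (1 < p ^ m)%N by rewrite -{1}(expn0 p) ltn_exp2l ?prime_gt1.
    by move: cb; rewrite /coprime gcd0n => /eqP ->.
  case: (egcdnP (p ^ m) (ltn0Sn b')) => km kn e _; exists km, kn.
  by rewrite e (eqP cb).
pose c := ((a' * u) %% p ^ m)%N.
exists c; first by rewrite ltn_mod expn_gt0 prime_gt0.
have -> : a%:F / b%:F - c%:R = (a - c%:R * b)%:F / b%:F.
  rewrite tofracB tofracM rmorph_nat mulrBl mulfK // tofrac_eq0 //.
rewrite padic_abs_frac // ler_pdivrMr // {2}/padicZ_abs (negbTE b0).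
rewrite -invfM -exprD padicZ_abs_le -/v -/M.
have key : residue (c%:R * b) M = residue a M.
  rewrite /= residue_nat modnMml eb ea mulnA /M expnD -!muln_modl.
  congr (_ * _)%N; rewrite /c modnMml -mulnA eu mulnDr muln1 mulnA.
  rewrite modnMDl modn_small //.
  have : (residue a M < p ^ M)%N.
    by rewrite -residue_mod ltn_mod expn_gt0 prime_gt0.
  by rewrite ea /M expnD ltn_mul2r => /andP[].
have h0 : residue (- (c%:R * b) + c%:R * b) M = 0%N by rewrite addNr /= mod0n.
by rewrite addrC; move: h0; rewrite /=; move: key; rewrite /= => -> ->.
Qed.

End PadicField.

(** * The additive character *)

Section CircleMap.
Variable R : realType.

Definition circle_map (r : R) : R[i] := (cos (2 * pi * r) +i* sin (2 * pi * r))%C.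

Lemma circle_mapD r s : circle_map (r + s) = circle_map r * circle_map s.
Proof.
rewrite /circle_map mulrDr cosD sinD; apply/eqP; rewrite eq_complex /=.
by apply/andP; split; apply/eqP; ring.
Qed.

Lemma circle_map0 : circle_map 0 = 1.
Proof. by rewrite /circle_map mulr0 cos0 sin0. Qed.

Lemma circle_map1 : circle_map 1 = 1.
Proof.
rewrite /circle_map mulr1 mulrC mulr_natr cos2pi.
by rewrite -[pi *+ 2]add0r sinD2pi sin0.
Qed.

Lemma circle_map_int (q : int) : circle_map q%:~R = 1.
Proof.
have nat (m : nat) : circle_map m%:R = 1.
  elim: m => [|m IH]; first exact: circle_map0.
  by rewrite -addn1 natrD circle_mapD IH circle_map1 mulr1.
case: q => m; first exact: nat.
rewrite NegzE -[LHS]mulr1 -(nat m.+1) -circle_mapD.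
by rewrite rmorphN /= addNr circle_map0.
Qed.

(** By the double angle formula, cos (2 pi r) = 1 forces sin (pi r) = 0, whereas the sine is
    positive strictly between 0 and pi. *)
Lemma circle_map_eq1 (r : R) : 0 <= r -> r < 1 -> circle_map r = 1 -> r = 0.
Proof.
move=> r0 r1 /eqP; rewrite eq_complex /= => /andP[/eqP c1 _].
apply/eqP; rewrite eq_le r0 andbT leNgt; apply/negP => rgt0.
have : 0 < sin (pi * r).
  apply: sin_gt0_pi; rewrite mulr_gt0 ?pi_gt0 //=.
  by rewrite -[ltRHS]mulr1 ltr_pM2l ?pi_gt0.
move: c1; have -> : 2 * pi * r = pi * r + pi * r by ring.
rewrite cosD; have := cos2Dsin2 (pi * r).
move: (sin _) (cos _) => s c; rewrite !expr2 => h1 h2 s0.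
have : s * s = 0 by lra.
by move/eqP; rewrite mulf_eq0 orbb => /eqP s00; rewrite s00 ltxx in s0.
Qed.

End CircleMap.

Section PadicChar.
Variables (R : realType) (p : nat) (p_pr : prime p).
Local Notation Qp := (padicQ R p_pr).
Implicit Types (x y : Qp).

Let p_gt0 : 0 < p%:R :> R. Proof. by rewrite ltr0n prime_gt0. Qed.
Let p_gt1 : 1 < p%:R :> R. Proof. by rewrite ltr1n prime_gt1. Qed.

Lemma padic_abs_le_pX x : exists k : nat, padic_abs x <= p%:R ^+ k.
Proof.
have [->|x0] := eqVneq x 0; first by exists 0%N; rewrite padic_abs0 ler01.
have [k [l ->]] := padic_abs_disc x0; exists k.
rewrite ler_pdivrMr ?exprn_gt0 //; apply: ler_peMr; rewrite ?exprn_ge0 ?(ltW p_gt0) //.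
by rewrite exprn_ege1 ?(ltW p_gt1).
Qed.

(** The case [m = 0] yields the fractional part, the case [m = k] the coset representatives. *)
Lemma padic_approx_frac x k m : padic_abs x <= p%:R ^+ k ->
  exists2 c : nat, (c < p ^ (k + m))%N &
    padic_abs (x - c%:R / p%:R ^+ k) <= (p%:R ^+ m)^-1.
Proof.
move=> xk; have : padic_abs (x * p%:R ^+ k) <= 1.
  by rewrite padic_absM padic_abs_pX ler_pdivrMr ?exprn_gt0 // mul1r.
move=> /(@padic_approx _ _ _ _ (k + m))[c c1 c2]; exists c => //.
have p0 : (p%:R ^+ k : Qp) != 0 by rewrite expf_neq0 // padic_p_neq0.
have -> : x - c%:R / p%:R ^+ k = (x * p%:R ^+ k - c%:R) / p%:R ^+ k.
  by rewrite mulrBl mulfK.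
rewrite padic_absM padic_absV padic_abs_pX invrK.
by rewrite -ler_pdivlMr ?exprn_gt0 // -invfM -exprD addnC.
Qed.

Lemma padic_fracP x : exists a k : nat, [/\ (a < p ^ k)%N,
  padic_frac x = a%:R / p%:R ^+ k & padic_abs (x - a%:R / p%:R ^+ k) <= 1].
Proof.
rewrite /padic_frac; case: xgetP => // none.
have [k xk] := padic_abs_le_pX x.
have [a a1 a2] := padic_approx_frac 0 xk.
case: (none (a%:R / p%:R ^+ k)); exists a, k; split=> //.
  by rewrite addn0 in a1.
by rewrite expr0 invr1 in a2.
Qed.

Lemma padic_abs_int_le (t : int) m :
  padic_abs (t%:~R : Qp) <= (p%:R ^+ m)^-1 -> exists q : int, t = q * (p ^ m)%:Z.
Proof.
case: t => k.
  by rewrite padic_abs_nat_le => /dvdnP[q ->]; exists q; rewrite PoszM.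
rewrite NegzE rmorphN padic_absN padic_abs_nat_le => /dvdnP[q ->].
by exists (- q%:Z); rewrite PoszM mulNr.
Qed.

(** The same expression is read in [Qp] and in [R]. Over the common denominator its numerator is one
    integer [t] in both fields; the p-adic bound says that the denominator divides [t], and this is
    a statement about integers that transfers to [R]. *)
Lemma padic_frac_congr (a b c k l m : nat) :
  padic_abs (a%:R / p%:R ^+ k + b%:R / p%:R ^+ l - c%:R / p%:R ^+ m : Qp) <= 1 ->
  exists q : int,
    a%:R / p%:R ^+ k + b%:R / p%:R ^+ l - c%:R / p%:R ^+ m = q%:~R :> R.
Proof.
pose t : int := a%:Z * (p ^ (l + m))%:Z + b%:Z * (p ^ (k + m))%:Z
                - c%:Z * (p ^ (k + l))%:Z.
have eqt (K : fieldType) : (p%:R : K) != 0 ->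
    a%:R / p%:R ^+ k + b%:R / p%:R ^+ l - c%:R / p%:R ^+ m =
    t%:~R / p%:R ^+ (k + l + m) :> K.
  move=> p0; rewrite /t rmorphB rmorphD !rmorphM /= -!pmulrn !natrX !exprD.
  by field; rewrite ?p0 ?expf_neq0.
rewrite (eqt Qp (padic_p_neq0 R p_pr)) padic_absM padic_absV padic_abs_pX invrK.
rewrite -ler_pdivlMr ?exprn_gt0 // mul1r => /padic_abs_int_le[q tq].
exists q; rewrite (eqt R) ?gt_eqF // tq rmorphM /= -pmulrn natrX mulfK //.
by rewrite expf_neq0 // gt_eqF.
Qed.

Lemma padic_charE x : padic_char x = circle_map (padic_frac x). Proof. by []. Qed.

(** Fractional parts are additive only up to an integer, which the circle map does not see. *)
Lemma padic_charD x y : padic_char (x + y) = padic_char x * padic_char y.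
Proof.
rewrite !padic_charE -circle_mapD.
have [a [k [_ -> xa]]] := padic_fracP x.
have [b [l [_ -> yb]]] := padic_fracP y.
have [c [m [_ -> xyc]]] := padic_fracP (x + y).
have : padic_abs (a%:R / p%:R ^+ k + b%:R / p%:R ^+ l - c%:R / p%:R ^+ m : Qp)
    <= 1.
  have -> : a%:R / p%:R ^+ k + b%:R / p%:R ^+ l - c%:R / p%:R ^+ m =
    (x + y - c%:R / p%:R ^+ m) - ((x - a%:R / p%:R ^+ k) + (y - b%:R / p%:R ^+ l)).
    by ring.
  by apply: padic_absB_le => //; apply: padic_absD_le.
move=> /padic_frac_congr[q qE].
have -> : a%:R / p%:R ^+ k + b%:R / p%:R ^+ l = c%:R / p%:R ^+ m + q%:~R :> R.
  by rewrite -qE [RHS]addrC subrK.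
by rewrite [RHS]circle_mapD circle_map_int mulr1.
Qed.

Lemma padic_frac_ge0 x : 0 <= padic_frac x.
Proof.
by have [a [k [_ -> _]]] := padic_fracP x; rewrite divr_ge0 ?exprn_ge0 ?ler0n.
Qed.

Lemma padic_frac_lt1 x : padic_frac x < 1.
Proof.
have [a [k [h -> _]]] := padic_fracP x.
by rewrite ltr_pdivrMr ?exprn_gt0 // mul1r -natrX ltr_nat.
Qed.

Lemma padic_frac_eq0 x : (padic_frac x = 0) <-> (padic_abs x <= 1).
Proof.
have [a [k [h e xa]]] := padic_fracP x; split.
  rewrite e => /eqP; rewrite mulf_eq0 invr_eq0 expf_eq0 (gt_eqF p_gt0) andbF orbF.
  rewrite pnatr_eq0 => /eqP a0; move: xa; by rewrite a0 mul0r subr0.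
move=> x1; rewrite e.
have : padic_abs (a%:R / p%:R ^+ k : Qp) <= 1.
  by rewrite -[_ / _](subKr x); apply: padic_absB_le.
rewrite padic_absM padic_absV padic_abs_pX invrK -ler_pdivlMr ?exprn_gt0 //.
rewrite mul1r padic_abs_nat_le => /dvdnP[q]; case: q => [|q] aq.
  by rewrite aq mul0n mul0r.
by move: h; rewrite aq ltnNge mulSn leq_addr.
Qed.

(** One direction makes Fourier integrals vanish, the other makes transforms of compactly supported
    functions locally constant. *)
Lemma padic_char_eq1 x : (padic_char x = 1) <-> (padic_abs x <= 1).
Proof.
rewrite -padic_frac_eq0 padic_charE; split => [|->]; last exact: circle_map0.
by apply: circle_map_eq1; rewrite ?padic_frac_ge0 ?padic_frac_lt1.
Qed.

End PadicChar.

(** * Polydiscs and step functions *)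

(** Pigeonhole for ultrafilters: either the last piece belongs to [F], or its complement does and
    the other pieces cover what remains of [A]. *)
Lemma ultra_finite_cover (T : Type) (F : set_system T) (B : nat -> set T)
    (A : set T) (K : nat) : UltraFilter F -> F A ->
  (forall x, A x -> exists2 c, (c < K)%N & B c x) -> exists2 c, (c < K)%N & F (B c).
Proof.
move=> UF; elim: K A => [|K IH] A FA cov.
  have [] := @filter_not_empty _ F _.
  by apply: filterS FA => x /cov[].
have [FB|FB] := in_ultra_setVsetC (B K) UF; first by exists K.
have [|x [Ax nBx]|c cK Fc] := IH (A `&` ~` B K).
- exact: filterI.
- have [c] := cov x Ax; rewrite ltnS leq_eqVlt => /orP[/eqP ->|cK Bc]; first by move/nBx.
  by exists c.
- by exists c => //; apply: ltnW.
Qed.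

Section PadicTopology.
Variables (R : realType) (p : nat) (p_pr : prime p).
Local Notation Zp := (padicZ p_pr).
Local Notation Qp := (padicQ R p_pr).

Let p_gt0 : 0 < p%:R :> R. Proof. by rewrite ltr0n prime_gt0. Qed.
Let p_gt1 : 1 < p%:R :> R. Proof. by rewrite ltr1n prime_gt1. Qed.

Lemma exp_pV_lt (e : R) : 0 < e -> exists m : nat, (p%:R ^+ m)^-1 < e.
Proof.
move=> e0; exists (Num.bound e^-1).
rewrite invf_plt ?posrE ?exprn_gt0 //.
apply: lt_le_trans (archi_boundP _) _; first by rewrite invr_ge0 ltW.
by rewrite -natrX ler_nat ltnW // ltn_expl // prime_gt1.
Qed.

(** For each [m] an ultrafilter on the ball selects a residue [c m] modulo p^m of x p^k. Residues of
    consecutive levels are compatible because two members of the ultrafilter meet, so they form an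
    element [z] of the inverse limit, and z / p^k is the limit point. *)
Lemma compact_padic_ball k : compact [set x : Qp | padic_abs x <= p%:R ^+ k].
Proof.
rewrite compact_ultra => F UF Fk.
have /choice[c cP] : forall m, exists c : nat,
    F [set x : Qp | padic_abs (x * p%:R ^+ k - c%:R) <= (p%:R ^+ m)^-1].
  move=> m; pose B c := [set x : Qp | padic_abs (x * p%:R ^+ k - c%:R) <= (p%:R ^+ m)^-1].
  suff [c _ Fc] : exists2 c, (c < p ^ m)%N & F (B c) by exists c.
  apply: (ultra_finite_cover UF Fk) => x /= xk; apply: padic_approx.
  by rewrite padic_absM padic_abs_pX ler_pdivrMr ?exprn_gt0 // mul1r.
have cE m : c m.+1 = c m %[mod p ^ m].
  have [x [/= x1 x2]] := filter_ex (filterI (cP m) (cP m.+1)).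
  have : padic_abs ((c m)%:R - (c m.+1)%:R : Qp) <= (p%:R ^+ m)^-1.
    have -> : (c m)%:R - (c m.+1)%:R =
      (x * p%:R ^+ k - (c m.+1)%:R) - (x * p%:R ^+ k - (c m)%:R) by ring.
    apply: padic_absB_le => //; apply: le_trans x2 _.
    exact: exp_pV_le.
  have -> : (c m)%:R - (c m.+1)%:R = ((c m)%:Z - (c m.+1)%:Z)%:~R :> Qp.
    by rewrite rmorphB.
  move=> /padic_abs_int_le[q qE].
  have : ((p ^ m)%N %| (c m)%:Z - (c m.+1)%:Z)%Z by rewrite qE dvdz_mull.
  by rewrite -eqz_mod_dvd !modz_nat => /eqP[->].
pose z : Zp := padicZ_mk p_pr cE.
pose x0 : Qp := (FracField.tofrac z : Qp) / p%:R ^+ k.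
have pk0 : (p%:R ^+ k : Qp) != 0 by rewrite padic_pX_neq0.
have zc m : padic_abs ((FracField.tofrac z : Qp) - (c m)%:R) <= (p%:R ^+ m)^-1.
  rewrite -(rmorph_nat (FracField.tofrac (R := Zp))) -tofracB.
  rewrite padic_abs_tofrac padicZ_abs_le.
  have h0 : residue (z - z) m = 0%N by rewrite subrr /= mod0n.
  have key : residue ((c m)%:R : Zp) m = residue z m by rewrite residue_nat.
  move: h0; rewrite /=; move: key; rewrite /= => <-.
  by move=> ->.
have Fx0 : F --> x0.
  move=> A /nbhs_ballP[e /= e0 eA].
  have [m me] := exp_pV_lt (divr_gt0 e0 (exprn_gt0 k p_gt0)).
  apply: filterS (cP m) => x /= xm; apply: eA => /=.
  rewrite -[ball _ _ _]/(is_true (padic_abs (x0 - x) < e)).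
  have -> : x0 - x = (((FracField.tofrac z : Qp) - (c m)%:R)
      - (x * p%:R ^+ k - (c m)%:R)) / p%:R ^+ k.
    by rewrite opprB addrA subrK mulrBl mulfK.
  rewrite padic_absM padic_absV padic_abs_pX invrK -ltr_pdivlMr ?exprn_gt0 //.
  by apply: le_lt_trans me; apply: padic_absB_le.
exists x0; split => //=.
rewrite /x0 padic_absM padic_absV padic_abs_pX invrK ler_piMl ?exprn_ge0 ?ler0n //.
rewrite padic_abs_tofrac; have := padicZ_abs_le R z 0; rewrite expr0 invr1 => ->.
by rewrite /= expn0 modn1.
Qed.

Variable n : nat.
Local Notation Qpn := 'rV[Qp]_n.
Implicit Types x y : Qpn.

Definition polydisc (e : R) : set Qpn := [set x | forall i, padic_abs (x 0 i) <= e].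

Lemma polydiscN e x : polydisc e x -> polydisc e (- x).
Proof. by move=> xe i; rewrite mxE padic_absN. Qed.

Lemma polydiscD e x y : polydisc e x -> polydisc e y -> polydisc e (x + y).
Proof. by move=> xe ye i; rewrite mxE; apply: padic_absD_le. Qed.

Lemma polydiscB e x y : polydisc e x -> polydisc e y -> polydisc e (x - y).
Proof. by move=> xe ye; apply: polydiscD => //; apply: polydiscN. Qed.

Lemma polydisc_sub e e' : e <= e' -> polydisc e `<=` polydisc e'.
Proof. by move=> ee x xe i; apply: le_trans ee. Qed.

Lemma polydisc_bound x : exists k : nat, polydisc (p%:R ^+ k) x.
Proof.
have /choice[k kP] : forall i, exists k : nat, padic_abs (x 0 i) <= p%:R ^+ k.
  by move=> i; apply: padic_abs_le_pX.
exists (\max_i k i)%N => i; apply: le_trans (kP i) _.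
by rewrite ler_eXn2l // leq_bigmax.
Qed.

Lemma nbhs_polydisc x (A : set Qpn) : nbhs x A <->
  exists m : nat, forall y, polydisc (p%:R ^+ m)^-1 (y - x) -> A y.
Proof.
split=> [/nbhs_ballP[e /= e0 eA]|[m mA]].
  have [m me] := exp_pV_lt e0; exists m => y yx; apply: eA.
  split=> // i j; rewrite ord1 -[ball _ _ _]/(is_true (padic_abs (x 0 j - y 0 j) < e)).
  by rewrite padic_abs_distC; have := yx j; rewrite !mxE => /le_lt_trans; apply.
apply/nbhs_ballP; exists (p%:R ^+ m)^-1; first by rewrite /= invr_gt0 exprn_gt0.
move=> y [_ xy]; apply: mA => i; rewrite !mxE padic_abs_distC ltW //.
exact: xy.
Qed.

Lemma compact_polydisc k : compact (polydisc (p%:R ^+ k)).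
Proof.
have := @rV_compact Qp n (fun=> [set x | padic_abs x <= p%:R ^+ k])
  (fun=> @compact_padic_ball k).
congr compact; apply/seteqP; split => x /= h i; have := h i;
  by rewrite (ord1 0) ?(ord1 ord0).
Qed.

(** A union of cosets of an open subgroup is open, and so is its complement. Measurability of step
    functions follows from this. *)
Lemma open_polydisc_coset A k :
  (forall x y, A x -> polydisc (p%:R ^+ k)^-1 y -> A (x + y)) -> open A.
Proof.
move=> hA; rewrite openE => x Ax; apply/nbhs_polydisc; exists k => y yx.
by rewrite -[y](subrK x) addrC; apply: hA.
Qed.

Lemma closed_polydisc_coset A k :
  (forall x y, A x -> polydisc (p%:R ^+ k)^-1 y -> A (x + y)) -> closed A.
Proof.
move=> hA; rewrite -openC; apply: (@open_polydisc_coset _ k) => x y nA yk Axy.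
by apply: nA; rewrite -[x](addrK y); apply: hA => //; apply: polydiscN.
Qed.

Lemma open_polydisc k : open (polydisc (p%:R ^+ k)).
Proof.
apply: (@open_polydisc_coset _ 0) => x y xk yk; apply: polydiscD => //.
by apply: polydisc_sub yk; rewrite expr0 invr1 exprn_ege1 // ltW.
Qed.

Lemma closed_polydisc k : closed (polydisc (p%:R ^+ k)).
Proof.
apply: (@closed_polydisc_coset _ 0) => x y xk yk; apply: polydiscD => //.
by apply: polydisc_sub yk; rewrite expr0 invr1 exprn_ege1 // ltW.
Qed.

(* The same N bounds the support and the invariance scale, so that the Fourier
   transform maps step functions of level N to step functions of level N. *)
Definition step_function (V : zmodType) (N : nat) (phi : Qpn -> V) : Prop :=
  (forall x, phi x != 0 -> polydisc (p%:R ^+ N) x) /\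
  (forall x y, polydisc (p%:R ^+ N)^-1 y -> phi (x + y) = phi x).

Lemma step_functionP (phi : Qpn -> R[i]) :
  schwartz_bruhat phi <-> exists N, step_function N phi.
Proof.
split=> [[lc cpt]|[N [supp inv]]].
  set K := closure _ in cpt.
  have Kphi x : ~ K x -> phi x = 0.
    by move=> nK; apply/eqP; apply: contra_notT nK => x0; apply: subset_closure.
  (* Near each point of the support all large levels satisfy [P]; compactness then yields a single
     level valid on the whole support. *)
  pose P (m : nat) (x : Qpn) := polydisc (p%:R ^+ m) x /\
    forall y, polydisc (p%:R ^+ m)^-1 y -> phi (x + y) = phi x.
  have /compact_near_coveringP/(_ nat \oo P _)[x Kx|m _ mP] := cpt.
    have /nbhs_polydisc[m mphi] := lc x.
    have [k xk] := polydisc_bound x.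
    exists (polydisc (p%:R ^+ m)^-1 \o (fun y => y - x), [set l | (maxn m k <= l)%N]).
      split; last by exists (maxn m k).
      by apply/nbhs_polydisc; exists m.
    move=> [x' l] [/= x'm]; rewrite geq_max => /andP[ml kl].
    have le1 : (p%:R ^+ l)^-1 <= (p%:R ^+ m)^-1 :> R.
      exact: exp_pV_le.
    split.
      rewrite -[x'](subrK x); apply: polydiscD; last first.
        by apply: polydisc_sub xk; rewrite ler_eXn2l.
      exact: (polydisc_sub (exp_pV_le_exp R p_pr _ _) x'm).
    move=> y yl; rewrite !mphi //.
    rewrite addrAC; apply: polydiscD => //.
    exact: polydisc_sub yl.
  have {mP} mP : K `<=` P m by apply: mP; exact: leqnn.
  exists m; split => [x x0|x y ym].
    by have [] := mP x; rewrite /K; [exact: subset_closure|].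
  have [Kx|nKx] := pselect (K x); first by have [_ ->] := mP x Kx.
  (* Invariance is known at points of [K] only; if just [x + y] lies there, it is applied at that
     point with [- y]. *)
  have [Kxy|nKxy] := pselect (K (x + y)); last by rewrite !Kphi.
  have [_ /(_ (- y))] := mP _ Kxy; rewrite addrK => -> //.
  exact: polydiscN.
split=> [x|].
  by apply/nbhs_polydisc; exists N => y yx; rewrite -[y](subrK x) addrC inv.
apply: subclosed_compact (compact_polydisc (k := N)) _; first exact: closed_closure.
rewrite [X in _ `<=` X](closure_id _).1; first exact: closureS.
exact: closed_polydisc.
Qed.

End PadicTopology.

(** * Haar measure *)

Section Representatives.
Variables (R : realType) (p : nat) (p_pr : prime p) (n : nat).
Local Notation Qp := (padicQ R p_pr).
Local Notation Qpn := 'rV[Qp]_n.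
Implicit Types x y : Qpn.

Let p_gt0 : 0 < p%:R :> R. Proof. by rewrite ltr0n prime_gt0. Qed.
Let p_gt1 : 1 < p%:R :> R. Proof. by rewrite ltr1n prime_gt1. Qed.

(** Representatives of (p^-N Z_p / p^N Z_p)^n: each factor has p^(2N) classes, those of c / p^N with
    c < p^(2N). *)
Definition coset_rep (N : nat) (a : {ffun 'I_n -> 'I_(p ^ (N + N))}) : Qpn :=
  \row_i ((a i)%:R / p%:R ^+ N).

Lemma coset_rep_cover N x : polydisc (p%:R ^+ N) x ->
  exists a, polydisc (p%:R ^+ N)^-1 (x - coset_rep (N := N) a).
Proof.
move=> xN.
have /choice[c cP] : forall i, exists c : 'I_(p ^ (N + N)),
    padic_abs (x 0 i - c%:R / p%:R ^+ N) <= (p%:R ^+ N)^-1.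
  by move=> i; have [c cN cx] := padic_approx_frac N (xN i); exists (Ordinal cN).
by exists (finfun c) => i; rewrite !mxE ffunE.
Qed.

Lemma coset_rep_polydisc N a : polydisc (p%:R ^+ N) (coset_rep (N := N) a).
Proof.
move=> i; rewrite mxE padic_absM padic_absV padic_abs_pX invrK.
by rewrite ler_piMl ?exprn_ge0 ?ler0n // padic_abs_nat_le1.
Qed.

Lemma coset_rep_inj N a b :
  polydisc (p%:R ^+ N)^-1 (coset_rep (N := N) a - coset_rep b) -> a = b.
Proof.
move=> ab; apply/ffunP => i; apply/val_inj => /=.
have := ab i; rewrite !mxE -mulrBl padic_absM padic_absV padic_abs_pX invrK.
rewrite -ler_pdivlMr ?exprn_gt0 // -invfM -exprD.
have -> : (a i)%:R - (b i)%:R = ((a i)%:Z - (b i)%:Z)%:~R :> Qp by rewrite rmorphB.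
move=> /padic_abs_int_le[q qE].
have : ((p ^ (N + N))%N %| (a i)%:Z - (b i)%:Z)%Z by rewrite qE dvdz_mull.
by rewrite -eqz_mod_dvd !modz_nat !modn_small // => /eqP[].
Qed.

(** The cosets are pairwise disjoint and cover the support, so at most one summand is nonzero. *)
Lemma step_function_sum N (g : Qpn -> R[i]) x : step_function N g ->
  g x = \sum_(a : {ffun 'I_n -> 'I_(p ^ (N + N))})
    g (coset_rep a) * (`[< polydisc (p%:R ^+ N)^-1 (x - coset_rep a) >])%:R.
Proof.
move=> [supp inv].
have [xN|xN] := pselect (polydisc (p%:R ^+ N) x).
  have [a xa] := coset_rep_cover xN.
  rewrite (bigD1 a) //= asboolT // mulr1 big1 ?addr0 => [|b ba].
    by rewrite -[RHS](inv _ _ xa) addrC subrK.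
  rewrite asboolF ?mulr0 // => xb; move/eqP: ba; apply; apply: coset_rep_inj.
  have -> : coset_rep b - coset_rep a = (x - coset_rep a) - (x - coset_rep b).
    by rewrite opprB [RHS]addrC addrA subrK.
  exact: polydiscB.
rewrite big1 => [|a _].
  by apply/eqP; apply: contra_notT xN => /supp.
rewrite asboolF ?mulr0 // => xa; apply: xN; rewrite -[x](subrK (coset_rep a)).
apply: polydiscD; last exact: coset_rep_polydisc.
exact: (polydisc_sub (exp_pV_le_exp R p_pr _ _) xa).
Qed.

Lemma step_function_bounded N (g : Qpn -> R[i]) : step_function N g ->
  exists B : R, forall x, Normc.normc (g x) <= B.
Proof.
move=> gN; exists (\sum_(a : {ffun 'I_n -> 'I_(p ^ (N + N))}) Normc.normc (g (coset_rep a))).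
move=> x; have s0 : 0 <= \sum_(a : {ffun 'I_n -> 'I_(p ^ (N + N))}) Normc.normc (g (coset_rep a)).
  by apply: sumr_ge0 => a _; case: (g _) => u v /=; apply: sqrtr_ge0.
have [xN|xN] := pselect (polydisc (p%:R ^+ N) x).
  have [a xa] := coset_rep_cover xN.
  have -> : g x = g (coset_rep a) by rewrite -[RHS](gN.2 _ _ xa) addrC subrK.
  rewrite (bigD1 a) //= lerDl.
  by apply: sumr_ge0 => b _; case: (g _) => u v /=; apply: sqrtr_ge0.
have -> : g x = 0 by apply/eqP; apply: contra_notT xN => /gN.1.
by rewrite Normc.normc0.
Qed.

End Representatives.

Section Integration.
Variables (R : realType) (p : nat) (p_pr : prime p) (n : nat).
Local Notation Qp := (padicQ R p_pr).
Local Notation Qpn := 'rV[Qp]_n.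
Local Notation T := (padic_borel R p_pr n).
Variable mu : {measure set T -> \bar R}.
Hypothesis mu_haar : normalized_haar mu.

Let p_gt0 : 0 < p%:R :> R. Proof. by rewrite ltr0n prime_gt0. Qed.
Let p_gt1 : 1 < p%:R :> R. Proof. by rewrite ltr1n prime_gt1. Qed.

Lemma open_borel (A : set Qpn) : open A -> measurable (A : set T).
Proof. by move=> oA; apply: sub_sigma_algebra. Qed.

Lemma measurable_polydisc k : measurable (polydisc (p%:R ^+ k) : set T).
Proof. by apply: open_borel; apply: open_polydisc. Qed.

Lemma haar_translate (a : Qpn) (A : set T) : measurable A ->
  mu [set x : Qpn | A (a + x)] = mu A.
Proof.
move=> mA; rewrite -(mu_haar.2 (- a) A mA); congr (mu _).
apply/seteqP; split => x /=; first by move=> Ax; exists (a + x) => //; rewrite addKr.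
by move=> [y Ay <-]; rewrite addNKr.
Qed.

(** Finitely many translates of Z_p^n, each of measure 1, cover the polydisc. *)
Lemma haar_polydisc_lty k : (mu (polydisc (p%:R ^+ k)) < +oo)%E.
Proof.
pose I := {ffun 'I_n -> 'I_(p ^ (k + k))}.
pose B (a : I) : set T := [set x : Qpn | polydisc 1 (- coset_rep R p_pr a + x)].
have mB0 : measurable (polydisc 1 : set T) by rewrite -[1](expr0 p%:R); exact: measurable_polydisc.
have mB a : measurable (B a).
  apply: open_borel; apply: (@open_polydisc_coset _ _ _ _ _ 0) => x y xB yB.
  by rewrite /B /= addrA; apply: polydiscD => //; move: yB; rewrite expr0 invr1.
apply: (@le_lt_trans _ _ (\sum_(a : I) mu (B a))%E).
  have [_ /(le_trans _)] : measurable (\big[setU/set0]_(a : I) B a) /\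
      (mu (\big[setU/set0]_(a : I) B a) <= \sum_(a : I) mu (B a))%E.
    apply: (big_ind2 (fun A r => measurable A /\ (mu A <= r)%E))
      => [|A r A' r' [mA Ar] [mA' Ar']|//].
      by rewrite measure0.
    split; first exact: measurableU.
    by apply: le_trans (measureU2 _ mA mA') _; apply: leeD.
  apply.
  apply: le_measure; rewrite ?inE.
  - exact: measurable_polydisc.
  - exact: bigsetU_measurable.
  - move=> x /coset_rep_cover[a xa]; rewrite (bigD1 a) //=; left.
    rewrite /B /= addrC; apply: polydisc_sub xa.
    exact: exp_pV_le1.
apply: lte_sum_pinfty => a _; rewrite haar_translate //.
by have [-> _] := mu_haar; rewrite ltry.
Qed.

Lemma integrable_polydisc k (f : T -> R) (B : R) : measurable_fun setT f ->
  (forall x, ~ polydisc (p%:R ^+ k) (x : Qpn) -> f x = 0) ->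
  (forall x, `|f x| <= B) -> mu.-integrable setT (EFin \o f).
Proof.
move=> mf f0 fB.
have -> : EFin \o f = (EFin \o f) \_ (polydisc (p%:R ^+ k)).
  apply/funext => x; rewrite patchE; case: ifPn => //.
  by rewrite notin_setE => /f0 /= ->.
rewrite -integrable_mkcond; last exact: measurable_polydisc.
apply: measurable_bounded_integrable.
- exact: measurable_polydisc.
- exact: haar_polydisc_lty.
- exact: measurable_funS mf.
- exists B; split; first exact: num_real.
  by move=> M BM x _; apply: le_trans (ltW BM).
Qed.

Lemma measurable_step_function k (V : zmodType) (g : Qpn -> V) (h : V -> R) :
  step_function k g -> measurable_fun setT (fun x : T => h (g x)).
Proof.
move=> [_ inv] _ Y mY; rewrite setTI; apply: open_borel.
by apply: (@open_polydisc_coset _ _ _ _ _ k) => x y /= xY yk; rewrite inv.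
Qed.

(** The image of [mu] under the translation agrees with [mu] on measurable sets, so this is a change
    of variables. *)
Lemma Rintegral_translate (f : T -> R) (a : Qpn) :
  mu.-integrable setT (EFin \o f) -> 
  mu.-integrable setT (EFin \o (fun x : T => f (a + x : Qpn))) -> 
  \int[mu]_x f (a + x : Qpn) = \int[mu]_x f x.
Proof.
move=> intf intf'; rewrite /Rintegral; congr fine.
have mphi : measurable_fun setT ((fun x : Qpn => a + x) : T -> T).
  apply: (@measurability _ _ T T setT _ (@open Qpn)) => // _ [A oA <-].
  rewrite setTI; apply: open_borel; rewrite openE => x Ax.
  have := oA; rewrite openE => /(_ _ Ax)/nbhs_polydisc[m mA].
  apply/nbhs_polydisc; exists m => y yx; apply: mA.
  by rewrite opprD addrACA subrr add0r.
rewrite -(@integral_pushforward _ _ _ _ _ _ mphi mu setT (EFin \o f)) //.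
- apply: eq_measure_integral => A mA _; rewrite /pushforward.
  by rewrite -[RHS](haar_translate a mA).
- exact: measurable_int intf.
Qed.

End Integration.

(** * The Fourier transform on Schwartz-Bruhat functions *)

Section ComplexIntegral.
Variables (R : realType) (p : nat) (p_pr : prime p) (n : nat).
Local Notation Qp := (padicQ R p_pr).
Local Notation Qpn := 'rV[Qp]_n.
Local Notation T := (padic_borel R p_pr n).
Local Notation C := R[i].
Implicit Types (phi g h : Qpn -> C).

Let p_gt0 : 0 < p%:R :> R. Proof. by rewrite ltr0n prime_gt0. Qed.
Let p_gt1 : 1 < p%:R :> R. Proof. by rewrite ltr1n prime_gt1. Qed.

Lemma step_function_widen M N g : (M <= N)%N -> step_function M g -> step_function N g.
Proof.
move=> MN [supp inv]; split=> [x /supp|x y yN].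
  by apply: polydisc_sub; rewrite ler_eXn2l.
by apply: inv; apply: polydisc_sub yN; rewrite lef_pV2 ?posrE ?exprn_gt0 // ler_eXn2l.
Qed.

(** Local constancy of [h] is asked only off the zeros of [g], because the intended factor |f|^s
    need not be locally constant at the origin. *)
Lemma schwartz_bruhat_mul g h :
  (forall x, g x != 0 -> \forall y \near x, h y = h x) ->
  schwartz_bruhat g -> schwartz_bruhat (fun x => h x * g x).
Proof.
move=> hg [lc cpt]; split=> [x|].
  have [gx0|gx0] := eqVneq (g x) 0.
    by apply: filterS (lc x) => y ->; rewrite gx0 !mulr0.
  by apply: filterS (filterI (lc x) (hg x gx0)) => y [-> ->].
apply: (subclosed_compact _ cpt); first exact: closed_closure.
by apply: closureS => x /=; apply: contra => /eqP ->; rewrite mulr0.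
Qed.

Lemma schwartz_bruhatD (a : C) g h : schwartz_bruhat g -> schwartz_bruhat h ->
  schwartz_bruhat (fun x => a * g x + h x).
Proof.
move=> /step_functionP[M gM] /step_functionP[N hN]; apply/step_functionP.
exists (maxn M N).
have [gs gi] := step_function_widen (leq_maxl M N) gM.
have [hs hi] := step_function_widen (leq_maxr M N) hN.
split=> [x|x y yMN]; last by rewrite gi ?hi.
have [gx0|gx0] := eqVneq (g x) 0; last by move=> _; apply: gs.
by rewrite gx0 mulr0 add0r; apply: hs.
Qed.

Lemma schwartz_bruhat_translate (a : Qpn) g : schwartz_bruhat g ->
  schwartz_bruhat (fun x => g (a + x)).
Proof.
move=> /step_functionP[M gM]; apply/step_functionP.
have [k ak] := polydisc_bound a; exists (maxn M k).
have [gs gi] := step_function_widen (leq_maxl M k) gM.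
split=> [x /gs ax|x y yM]; last by rewrite addrA; apply: gi.
rewrite -[x](addKr a) addrC; apply: polydiscB => //.
by apply: polydisc_sub ak; rewrite ler_eXn2l // leq_maxr.
Qed.

Lemma complex_Re_le (z : C) : `|complex.Re z| <= Normc.normc z.
Proof.
by case: z => u v /=; rewrite -sqrtr_sqr ler_wsqrtr // lerDl sqr_ge0.
Qed.

Lemma complex_Im_le (z : C) : `|complex.Im z| <= Normc.normc z.
Proof.
by case: z => u v /=; rewrite -sqrtr_sqr ler_wsqrtr // lerDr sqr_ge0.
Qed.

Variable mu : {measure set T -> \bar R}.
Hypothesis mu_haar : normalized_haar mu.

Lemma schwartz_bruhat_integrable g (F : C -> R) : F 0 = 0 ->
  (forall z, `|F z| <= Normc.normc z) -> schwartz_bruhat g ->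
  mu.-integrable setT (EFin \o (fun x : T => F (g x))).
Proof.
move=> F0 FN /step_functionP[N gN].
have [B gB] := step_function_bounded gN.
apply: (integrable_polydisc mu_haar (k := N) (B := B)).
- exact: (measurable_step_function F gN).
- move=> x xN; have -> : g x = 0; last by [].
  by apply/eqP; apply: contra_notT xN => /gN.1.
- by move=> x; apply: le_trans (FN _) (gB x).
Qed.

Let integrable_Re g : schwartz_bruhat g ->
  mu.-integrable setT (EFin \o (fun x : T => complex.Re (g x))).
Proof. by apply: schwartz_bruhat_integrable; [|exact: complex_Re_le]. Qed.

Let integrable_Im g : schwartz_bruhat g ->
  mu.-integrable setT (EFin \o (fun x : T => complex.Im (g x))).
Proof. by apply: schwartz_bruhat_integrable; [|exact: complex_Im_le]. Qed.

Lemma Cintegral_linear (a : C) g h : schwartz_bruhat g -> schwartz_bruhat h ->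
  Cintegral mu (fun x => a * g x + h x) = a * Cintegral mu g + Cintegral mu h.
Proof.
move=> gS hS; have [gr gi] := (integrable_Re gS, integrable_Im gS).
have [hr hi] := (integrable_Re hS, integrable_Im hS).
have ZI (r : R) (f : T -> R) : mu.-integrable setT (EFin \o f) ->
    mu.-integrable setT (EFin \o (fun x => r * f x)).
  by move=> fi; have := integrableZl measurableT r fi.
rewrite /Cintegral.
have -> : (fun x : T => complex.Re (a * g x + h x)) =
    (fun x => complex.Re a * complex.Re (g x) + - complex.Im a * complex.Im (g x)
              + complex.Re (h x)).
  by apply/funext => x; case: a (g x) (h x) => [? ?] [? ?] [? ?] /=; rewrite mulNr.
have -> : (fun x : T => complex.Im (a * g x + h x)) =
    (fun x => complex.Re a * complex.Im (g x) + complex.Im a * complex.Re (g x)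
              + complex.Im (h x)).
  by apply/funext => x; case: a (g x) (h x) => [? ?] [? ?] [? ?] /=; rewrite addrC.
have DI (f1 f2 : T -> R) : mu.-integrable setT (EFin \o f1) ->
    mu.-integrable setT (EFin \o f2) ->
    mu.-integrable setT (EFin \o (fun x => f1 x + f2 x)).
  by move=> i1 i2; have := integrableD measurableT i1 i2.
rewrite !(RintegralD measurableT); try by auto.
rewrite !(RintegralZl _ measurableT) //.
move: (\int[mu]_x complex.Re (g x)) (\int[mu]_x complex.Im (g x)).
move: (\int[mu]_x complex.Re (h x)) (\int[mu]_x complex.Im (h x)).
case: a => a1 a2 u1 u2 v1 v2; apply/eqP; rewrite eq_complex /=.
by apply/andP; split; apply/eqP; ring.
Qed.

Lemma Cintegral_translate (a : Qpn) g : schwartz_bruhat g ->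
  Cintegral mu (fun x => g (a + x)) = Cintegral mu g.
Proof.
move=> gS; have gS' := schwartz_bruhat_translate a gS; rewrite /Cintegral.
have := Rintegral_translate mu_haar (a := a) (integrable_Re gS) (integrable_Re gS').
have := Rintegral_translate mu_haar (a := a) (integrable_Im gS) (integrable_Im gS').
by move=> -> ->.
Qed.

Lemma padic_dotDl (x y z : Qpn) : padic_dot (x + y) z = padic_dot x z + padic_dot y z.
Proof. by rewrite -big_split; apply: eq_bigr => i _; rewrite mxE mulrDl. Qed.

Lemma padic_dotDr (x y z : Qpn) : padic_dot z (x + y) = padic_dot z x + padic_dot z y.
Proof. by rewrite -big_split; apply: eq_bigr => i _; rewrite mxE mulrDr. Qed.

Lemma padic_dot_le (k l : R) (x y : Qpn) : 0 <= k -> 0 <= l ->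
  polydisc k x -> polydisc l y -> padic_abs (padic_dot x y) <= k * l.
Proof.
move=> k0 l0 xk yl; apply: padic_abs_sum_le => [|i _]; first exact: mulr_ge0.
by rewrite padic_absM ler_pM ?padic_abs_ge0.
Qed.

Lemma schwartz_bruhat_char (y : Qpn) g : schwartz_bruhat g ->
  schwartz_bruhat (fun x => padic_char (padic_dot x y) * g x).
Proof.
apply: schwartz_bruhat_mul => x _; have [k yk] := polydisc_bound y.
apply/nbhs_polydisc; exists k => z zx.
rewrite -[z](subrK x) padic_dotDl padic_charD.
rewrite (padic_char_eq1 _).2 ?mul1r //.
have := padic_dot_le _ _ zx yk; rewrite mulVf ?expf_neq0 ?gt_eqF //.
by apply; rewrite ?invr_ge0 exprn_ge0 // ltW.
Qed.

Lemma padic_dotNr (x y : Qpn) : padic_dot x (- y) = - padic_dot x y.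
Proof. by rewrite -sumrN; apply: eq_bigr => i _; rewrite mxE mulrN. Qed.

Lemma schwartz_bruhat_fourier_integrand (xi : Qpn) g : schwartz_bruhat g ->
  schwartz_bruhat (fun x => padic_char (- padic_dot x xi) * g x).
Proof.
move=> /(schwartz_bruhat_char (- xi)); congr schwartz_bruhat.
by apply/funext => x; rewrite padic_dotNr.
Qed.

Lemma fourier_linear (a : C) g h : schwartz_bruhat g -> schwartz_bruhat h ->
  fourier mu (fun x => a * g x + h x) = fun xi => a * fourier mu g xi + fourier mu h xi.
Proof.
move=> gS hS; apply/funext => xi; rewrite /fourier.
rewrite -(Cintegral_linear a); try exact: schwartz_bruhat_fourier_integrand.
by congr (Cintegral mu _); apply/funext => x; ring.
Qed.

Lemma Cintegral0 : Cintegral mu (fun _ : Qpn => 0 : C) = 0.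
Proof. by rewrite /Cintegral /= Rintegral_cst ?mul0r. Qed.

Lemma schwartz_bruhat0 : schwartz_bruhat (fun _ : Qpn => 0 : C).
Proof. by apply/step_functionP; exists 0%N; split=> // x; rewrite eqxx. Qed.

Lemma fourierZ (a : C) g : schwartz_bruhat g ->
  fourier mu (fun x => a * g x) = fun xi => a * fourier mu g xi.
Proof.
move=> gS; have := fourier_linear a gS schwartz_bruhat0.
have -> : (fun x => a * g x + 0) = (fun x => a * g x).
  by apply/funext => x; rewrite addr0.
move=> ->; apply/funext => xi; have -> : fourier mu (fun=> 0) xi = 0; last by rewrite addr0.
rewrite /fourier -[RHS]Cintegral0; congr (Cintegral mu _).
by apply/funext => x; rewrite mulr0.
Qed.

(* Translation by a multiplies the integral by a character value other than 1. *)
Lemma fourier_eq0 g (a xi : Qpn) : schwartz_bruhat g ->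
  (forall x, g (a + x) = g x) -> 1 < padic_abs (padic_dot a xi) -> fourier mu g xi = 0.
Proof.
move=> gS ga axi.
have gF := schwartz_bruhat_fourier_integrand xi gS.
pose c : C := padic_char (- padic_dot a xi).
have c1 : c != 1.
  by apply/eqP => /padic_char_eq1; rewrite padic_absN leNgt axi.
have e : c * fourier mu g xi = fourier mu g xi.
  rewrite /fourier -[in RHS](Cintegral_translate a gF).
  have := Cintegral_linear c gF schwartz_bruhat0; rewrite Cintegral0 addr0 => <-.
  congr (Cintegral mu _); apply/funext => x.
  by rewrite ga padic_dotDl opprD padic_charD addr0 mulrA.
apply/eqP; move/eqP: e; rewrite -subr_eq0 -{2}[fourier _ _ _]mul1r -mulrBl.
by rewrite mulf_eq0 subr_eq0 (negbTE c1).
Qed.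

(** Choose a coordinate with |xi_i| > r and put 1 / (p xi_i) there: the pairing is 1 / p, of
    absolute value p. That this vector has size at most 1 / r needs |xi_i| >= p r, which holds
    because absolute values are powers of p and so is [r]. *)
Lemma polydisc_dual (xi : Qpn) (r : R) (k l : nat) : r = p%:R ^+ k / p%:R ^+ l ->
  ~ polydisc r xi -> exists2 a : Qpn, polydisc r^-1 a & 1 < padic_abs (padic_dot a xi).
Proof.
move=> rE /existsNP[i /negP]; rewrite -ltNge => xii.
have xi0 : xi 0 i != 0.
  rewrite -padic_abs_gt0; apply: le_lt_trans xii.
  by rewrite rE divr_ge0 ?exprn_ge0 // ltW.
have r0 : 0 < r by rewrite rE divr_gt0 ?exprn_gt0.
exists (\row_j (if j == i then (p%:R * xi 0 i)^-1 else 0)).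
  move=> j; rewrite mxE; case: eqP => _; last by rewrite padic_abs0 invr_ge0 ltW.
  rewrite padic_absV padic_absM padic_abs_p.
  rewrite lef_pV2 ?posrE //; last by rewrite mulr_gt0 ?invr_gt0 ?padic_abs_gt0.
  have [k' [l' e]] := padic_abs_disc xi0; rewrite e.
  move: xii; rewrite e rE ltr_pdivrMr ?exprn_gt0 // mulrAC ltr_pdivlMr ?exprn_gt0 //.
  rewrite -!exprD ltr_eXn2l // => kl.
  rewrite ler_pdivrMr ?exprn_gt0 // mulrA mulrAC ler_pdivlMr ?exprn_gt0 //.
  by rewrite -mulrA -!exprD ler_pdivlMl // -exprS ler_eXn2l.
rewrite /padic_dot (bigD1 i) //= mxE eqxx big1 ?addr0 => [|j /negbTE ji].
  rewrite padic_absM padic_absV padic_absM padic_abs_p invfM invrK mulfVK //.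
  by rewrite padic_abs_eq0.
by rewrite mxE ji mul0r.
Qed.

(** Support and invariance trade places: invariance of [g] at scale p^-N kills the transform outside
    the dual polydisc, and the support bound of [g] makes the character blind to shifts of [xi] at
    that scale. *)
Lemma fourier_step_function N g : step_function N g -> step_function N (fourier mu g).
Proof.
move=> gN; have gS : schwartz_bruhat g by apply/step_functionP; exists N.
have [supp inv] := gN; split=> [xi|xi eta etaN].
  apply: contra_neqP => xiN.
  have [|a aN axi] := polydisc_dual (k := N) (l := 0) _ xiN.
    by rewrite expr0 divr1.
  by apply: fourier_eq0 axi => // x; rewrite addrC inv.
rewrite /fourier; congr (Cintegral mu _); apply/funext => x.
have [->|gx0] := eqVneq (g x) 0; first by rewrite !mulr0.
rewrite padic_dotDr opprD padic_charD [X in _ * X * _](padic_char_eq1 _).2 ?mulr1 //.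
rewrite padic_absN.
have := padic_dot_le _ _ (supp x gx0) etaN; rewrite mulfV ?expf_neq0 ?gt_eqF //.
by apply; rewrite ?invr_ge0 exprn_ge0 // ltW.
Qed.

Lemma schwartz_bruhat_fourier g : schwartz_bruhat g -> schwartz_bruhat (fourier mu g).
Proof.
move=> /step_functionP[N gN]; apply/step_functionP; exists N.
exact: fourier_step_function.
Qed.

Definition polydisc_indicator (r : R) (x : Qpn) : C := (`[< polydisc r x >])%:R.

Lemma step_polydisc_indicator N : step_function N (polydisc_indicator (p%:R ^+ N)).
Proof.
split=> [x|x y yN]; rewrite /polydisc_indicator.
  by case: asboolP => //; rewrite eqxx.
have yN' : polydisc (p%:R ^+ N) y.
  exact: (polydisc_sub (exp_pV_le_exp R p_pr _ _) yN).
congr (_ %:R); congr (nat_of_bool _); apply: asbool_equiv_eq; split => h.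
  by rewrite -[x](addrK y); apply: polydiscB.
exact: polydiscD.
Qed.

(** Here [c] is the volume of the polydisc, nonzero since it contains Z_p^n. On the dual polydisc
    the transform is constant and is evaluated at 0; elsewhere a translation inside the polydisc
    makes it vanish. *)
Lemma fourier_polydisc_indicator N : exists2 c : C, c != 0 &
  fourier mu (polydisc_indicator (p%:R ^+ N)) =
  fun xi => c * polydisc_indicator (p%:R ^+ N)^-1 xi.
Proof.
have iN := step_polydisc_indicator N.
have iS : schwartz_bruhat (polydisc_indicator (p%:R ^+ N)).
  by apply/step_functionP; exists N.
have muN : mu (polydisc (p%:R ^+ N)) \is a fin_num.
  rewrite ge0_fin_numE ?measure_ge0 //; exact: haar_polydisc_lty.
pose m := fine (mu (polydisc (p%:R ^+ N))).
have m0 : m != 0.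
  rewrite gt_eqF // -lte_fin fineK //.
  apply: (@lt_le_trans _ _ (mu (polydisc 1))); first by rewrite mu_haar.1 lte01.
  apply: le_measure; rewrite ?inE.
  - by rewrite -[1](expr0 p%:R); exact: measurable_polydisc.
  - exact: measurable_polydisc.
  - by apply: polydisc_sub; rewrite exp_p_ge1.
exists m%:C%C.
  by rewrite eq_complex /= eqxx andbT.
apply/funext => xi; rewrite {2}/polydisc_indicator; case: asboolP => xiN; last first.
  rewrite mulr0.
  have [|a] := polydisc_dual (k := 0) (l := N) _ xiN; first by rewrite expr0 div1r.
  rewrite invrK => aN; apply: fourier_eq0 => // x.
  congr (_ %:R); congr (nat_of_bool _); apply: asbool_equiv_eq; split => h.
    by rewrite -[x](addKr a) addrC; apply: polydiscB.
  exact: polydiscD.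
rewrite mulr1 -[xi]add0r (fourier_step_function iN).2 //.
rewrite /fourier.
have -> : (fun x : Qpn => padic_char (- padic_dot x 0) * polydisc_indicator (p%:R ^+ N) x)
    = (fun x => (\1_(polydisc (p%:R ^+ N)) x)%:C%C).
  apply/funext => x; rewrite /padic_dot big1 ?oppr0 => [|i _]; last by rewrite mxE mulr0.
  rewrite (padic_char_eq1 _).2 ?padic_abs0 // mul1r indicE.
  by rewrite /polydisc_indicator -[_ \in _]/(`[< _ >]); case: (`[< _ >]).
rewrite /Cintegral /= Rintegral_cst // mul0r /Rintegral.
by rewrite integral_indic ?setIT //; exact: measurable_polydisc.
Qed.

(* The preimage of the indicator of b + p^N Z_p^n is, up to a constant, the character
   x |-> Psi(x . b) cut off to the dual polydisc. *)
Lemma fourier_surjective g : schwartz_bruhat g ->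
  exists2 psi, schwartz_bruhat psi & fourier mu psi = g.
Proof.
move=> /step_functionP[N gN].
pose I := {ffun 'I_n -> 'I_(p ^ (N + N))}.
have [c c0 cE] := fourier_polydisc_indicator N.
pose i := polydisc_indicator (p%:R ^+ N).
have iS : schwartz_bruhat i.
  by apply/step_functionP; exists N; exact: step_polydisc_indicator.
pose e (b : Qpn) x := c^-1 * (padic_char (padic_dot x b) * i x).
have eS b : schwartz_bruhat (e b).
  have := schwartz_bruhatD c^-1 (schwartz_bruhat_char b iS) schwartz_bruhat0.
  by congr schwartz_bruhat; apply/funext => x; rewrite addr0.
have eF b : fourier mu (e b) = fun xi => polydisc_indicator (p%:R ^+ N)^-1 (xi - b).
  rewrite fourierZ; last exact: schwartz_bruhat_char.
  apply/funext => xi.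
  have -> : fourier mu (fun x => padic_char (padic_dot x b) * i x) xi = fourier mu i (xi - b).
    rewrite /fourier; congr (Cintegral mu _); apply/funext => x.
    by rewrite mulrA -padic_charD padic_dotDr padic_dotNr opprD opprK.
  by rewrite cE mulKf.
have [psi psiS psiE] : exists2 psi, schwartz_bruhat psi & fourier mu psi =
    fun xi => \sum_(a : I) g (coset_rep R p_pr a) *
      polydisc_indicator (p%:R ^+ N)^-1 (xi - coset_rep R p_pr a).
  elim: (index_enum I) => [|a s [psi psiS psiE]].
    exists (fun=> 0); first exact: schwartz_bruhat0.
    apply/funext => xi; rewrite big_nil /fourier -[RHS]Cintegral0.
    by congr (Cintegral mu _); apply/funext => x; rewrite mulr0.
  exists (fun x => g (coset_rep R p_pr a) * e (coset_rep R p_pr a) x + psi x).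
    exact: schwartz_bruhatD.
  by rewrite fourier_linear // eF psiE; apply/funext => xi; rewrite big_cons.
by exists psi => //; rewrite psiE; apply/funext => xi; rewrite (step_function_sum xi gN).
Qed.

End ComplexIntegral.

(** * Quasielliptic polynomials *)

Section Quasielliptic.
Variables (R : realType) (p : nat) (p_pr : prime p) (n : nat).
Local Notation Qp := (padicQ R p_pr).
Local Notation Qpn := 'rV[Qp]_n.
Local Notation C := R[i].
Implicit Types x y xi : Qpn.

Let p_gt0 : 0 < p%:R :> R. Proof. by rewrite ltr0n prime_gt0. Qed.
Let p_gt1 : 1 < p%:R :> R. Proof. by rewrite ltr1n prime_gt1. Qed.

Definition padic_eval (f : mpoly.mpoly n Qp) x : Qp := mpoly.meval (fun i => x 0 i) f.

Lemma padic_eval_lipschitz f x y (e : R) : padic_integral_coeffs f -> 0 <= e ->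
  polydisc 1 x -> polydisc 1 y -> polydisc e (x - y) ->
  padic_abs (padic_eval f x - padic_eval f y) <= e.
Proof.
move=> fint e0 x1 y1 xy; rewrite /padic_eval !mpoly.mevalE -sumrB.
apply: padic_abs_sum_le => // m _; rewrite -mulrBr padic_absM.
(* Being bounded by 1 and [e]-close is stable under products, by aa' - bb' = (a - b)a' + b(a' - b');
   hence it passes to monomials. *)
pose P (a b : Qp) := [/\ padic_abs a <= 1, padic_abs b <= 1 & padic_abs (a - b) <= e].
have P1 : P 1 1 by split; rewrite ?padic_abs1 // subrr padic_abs0.
have PM a b a' b' : P a b -> P a' b' -> P (a * a') (b * b').
  move=> [a1 b1 ab] [a1' b1' ab']; split.
  - by rewrite padic_absM mulr_ile1 ?padic_abs_ge0.
  - by rewrite padic_absM mulr_ile1 ?padic_abs_ge0.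
  have -> : a * a' - b * b' = (a - b) * a' + b * (a' - b') by ring.
  apply: padic_absD_le; rewrite padic_absM.
    by rewrite -[e]mulr1 ler_pM ?padic_abs_ge0.
  by rewrite -[e]mul1r ler_pM ?padic_abs_ge0.
have [_ _ h] : P (\prod_i x 0 i ^+ mpoly.fun_of_multinom m i)
                 (\prod_i y 0 i ^+ mpoly.fun_of_multinom m i).
  apply: (big_ind2 P) => // i _; elim: (mpoly.fun_of_multinom m i) => [|k IH].
    by rewrite !expr0.
  by rewrite !exprS; apply: PM => //; split => //; have := xy i; rewrite !mxE.
by rewrite -[e]mul1r ler_pM ?padic_abs_ge0.
Qed.

Variables (f : mpoly.mpoly n Qp) (d : nat) (w : 'I_n -> nat).
Hypotheses (f_int : padic_integral_coeffs f) (f_qell : quasielliptic f d w).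

Let w_gt0 i : (0 < w i)%N. Proof. by case: f_qell. Qed.

Definition weighted_scale (l : Qp) x : Qpn := \row_i (l ^+ w i * x 0 i).

Lemma padic_eval_scale l x : l != 0 ->
  padic_eval f (weighted_scale l x) = l ^+ d * padic_eval f x.
Proof.
move=> l0; case: f_qell => _ _ /(_ l (fun i => x 0 i) l0) <- _.
by rewrite /padic_eval; congr mpoly.meval; apply/funext => i; rewrite mxE.
Qed.

Lemma padic_eval_eq0 x : padic_eval f x = 0 <-> x = 0.
Proof.
case: f_qell => _ _ _ /(_ (fun i => x 0 i)) h; split=> [/h x0|x0E].
  by apply/rowP => i; rewrite x0 mxE.
by apply: h.2 => i; rewrite x0E mxE.
Qed.

Lemma quasi_norm_scale l x :
  quasi_norm d w (weighted_scale l x) = padic_abs l ^+ d * quasi_norm d w x.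
Proof.
rewrite /quasi_norm mulr_sumr; apply: eq_bigr => i _.
rewrite mxE padic_absM padic_absX powRM ?exprn_ge0 ?padic_abs_ge0 //.
rewrite -powR_mulrn ?padic_abs_ge0 // -powRrM -powR_mulrn ?padic_abs_ge0 //.
by congr (_ `^ _ * _); rewrite mulrC divfK // pnatr_eq0 -lt0n.
Qed.

Lemma quasi_norm_ge0 x : 0 <= quasi_norm d w x.
Proof. by apply: sumr_ge0 => i _; apply: powR_ge0. Qed.

Lemma polydisc_scale_p k x (e : R) : 0 <= e -> polydisc e x ->
  polydisc ((p%:R ^+ k)^-1 * e) (weighted_scale (p%:R ^+ k) x).
Proof.
move=> e0 xe i; rewrite mxE padic_absM -exprM padic_abs_pX.
rewrite ler_pM ?invr_ge0 ?exprn_ge0 ?padic_abs_ge0 ?(ltW p_gt0) //.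
by rewrite lef_pV2 ?posrE ?exprn_gt0 // ler_eXn2l // leq_pmulr.
Qed.

(** The Lipschitz estimate lives on the unit polydisc, so [x] and [y] are first scaled into it by
    p^k. This multiplies values of [f] by (p^k)^d, and [m] is chosen to make the scaled difference
    smaller than the scaled |f(x)|. *)
Lemma padic_eval_abs_near x : x != 0 ->
  \forall y \near x, padic_abs (padic_eval f y) = padic_abs (padic_eval f x).
Proof.
move=> x0; have [k xk] := polydisc_bound x.
have pk0 : (p%:R ^+ k : Qp) != 0 by rewrite padic_pX_neq0.
have fx0 : 0 < padic_abs (padic_eval f x).
  by rewrite padic_abs_gt0; apply/eqP => /padic_eval_eq0/eqP; rewrite (negbTE x0).
have ld0 : 0 < padic_abs (p%:R ^+ k : Qp) ^+ d.
  by rewrite padic_abs_pX exprn_gt0 // invr_gt0 exprn_gt0.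
have [m me] := exp_pV_lt p_pr (mulr_gt0 ld0 fx0).
apply/nbhs_polydisc; exists m => y yx; apply: padic_abs_eq_of_lt.
have yx' : polydisc (p%:R ^+ k) (y - x).
  exact: (polydisc_sub (exp_pV_le_exp R p_pr _ _) yx).
have yk : polydisc (p%:R ^+ k) y by rewrite -[y](subrK x); apply: polydiscD.
have scale1 z : polydisc (p%:R ^+ k) z -> polydisc 1 (weighted_scale (p%:R ^+ k) z).
  move=> /polydisc_scale_p -/(_ k); rewrite mulVf ?expf_neq0 ?gt_eqF //; apply.
  by rewrite exprn_ge0 // ltW.
have scaleB : padic_abs (p%:R ^+ k : Qp) ^+ d * padic_abs (padic_eval f x - padic_eval f y) =
    padic_abs (padic_eval f (weighted_scale (p%:R ^+ k) x) -
               padic_eval f (weighted_scale (p%:R ^+ k) y)).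
  by rewrite !padic_eval_scale // -mulrBr [RHS]padic_absM (padic_absX (p%:R ^+ k) d).
rewrite -(ltr_pM2l ld0) scaleB; apply: le_lt_trans me.
have pm0 : 0 <= (p%:R ^+ m)^-1 :> R by rewrite invr_ge0 exprn_ge0 // ltW.
apply: padic_eval_lipschitz => //; [exact: scale1|exact: scale1|].
have -> : weighted_scale (p%:R ^+ k) x - weighted_scale (p%:R ^+ k) y =
    - weighted_scale (p%:R ^+ k) (y - x).
  by apply/rowP => i; rewrite !mxE; ring.
apply: polydiscN; apply: polydisc_sub (polydisc_scale_p k _ yx).
  by rewrite ler_piMl ?invr_ge0 ?exprn_ge0 ?invf_le1 ?exprn_gt0 ?exprn_ege1 // ltW.
by rewrite invr_ge0 exprn_ge0 // ltW.
Qed.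

(** Scaling by 1 / p multiplies the i-th absolute value by p^(w i). The second condition is a closed
    relaxation of the requirement that one such scaling leaves the unit polydisc. *)
Definition weighted_shell : set Qpn :=
  [set x | polydisc 1 x /\ exists i, (p%:R ^+ w i)^-1 <= padic_abs (x 0 i)].

Lemma weighted_shell_neq0 x : weighted_shell x -> x != 0.
Proof.
move=> [_ [i xi]]; apply/eqP => x0; move: xi; rewrite x0 mxE padic_abs0.
by rewrite leNgt invr_gt0 exprn_gt0.
Qed.

Lemma weighted_shell_compact : compact weighted_shell.
Proof.
(* As [W] exceeds every weight, a perturbation of size p^-W preserves |x_i| in any coordinate that
   is at least p^-(w i); the shell is thus a union of cosets. *)
pose W := (\max_i w i).+1.
apply: (subclosed_compact _ (@compact_polydisc R p p_pr n 0)) => [|x [x1 _]]; last by rewrite expr0.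
have small x y : polydisc (p%:R ^+ W)^-1 y ->
    forall i, (p%:R ^+ w i)^-1 <= padic_abs (x 0 i) -> padic_abs ((x + y) 0 i) = padic_abs (x 0 i).
  move=> yW i xi; apply: padic_abs_eq_of_lt; rewrite mxE opprD addNKr padic_absN.
  apply: le_lt_trans (yW i) _; apply: lt_le_trans xi.
  by rewrite ltf_pV2 ?posrE ?exprn_gt0 // ltr_eXn2l // ltnS leq_bigmax.
apply: (@closed_polydisc_coset _ _ _ _ _ W) => x y [x1 [i xi]] yW; split.
  apply: polydiscD => //; apply: polydisc_sub yW.
  exact: exp_pV_le1.
by exists i; rewrite small.
Qed.

(** Scaling by p^k brings [x] into Z_p^n; then divide the scaling factor by the largest p^j that
    keeps it there. A nonzero coordinate bounds [j], and the failure at [j.+1] exhibits the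
    coordinate required by the shell. *)
Lemma weighted_shell_scale x : x != 0 ->
  exists2 l : Qp, l != 0 & weighted_shell (weighted_scale l x).
Proof.
move=> x0; have [k xk] := polydisc_bound x.
have /existsNP[i /eqP xi0] : ~ forall i, x 0 i = 0.
  by move=> xi; move/eqP: x0; apply; apply/rowP => i; rewrite xi mxE.
have pX0 j : (p%:R ^+ j : Qp) != 0 by rewrite padic_pX_neq0.
pose l (j : nat) : Qp := p%:R ^+ k / p%:R ^+ j.
have labs j : padic_abs (l j) = (p%:R ^+ k)^-1 * p%:R ^+ j.
  by rewrite padic_absM padic_absV !padic_abs_pX invrK.
pose P (j : nat) := `[< polydisc 1 (weighted_scale (l j) x) >].
have P0 : exists j, P j.
  exists 0%N; apply/asboolP; have := polydisc_scale_p k _ xk.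
  rewrite /l expr0 divr1 mulVf ?expf_neq0 ?gt_eqF //; apply.
  by rewrite exprn_ge0 // ltW.
have [m xm] : exists m : nat, (p%:R ^+ m)^-1 < padic_abs (x 0 i).
  by apply: exp_pV_lt => //; rewrite padic_abs_gt0.
have Pbound j : P j -> (j <= k + m)%N.
  move=> /asboolP/(_ i); rewrite mxE padic_absM padic_absX => h.
  rewrite leqNgt; apply/negP => kmj; move: h; apply/negP; rewrite -ltNge.
  have l1 : p%:R ^+ m <= padic_abs (l j).
    by rewrite labs ler_pdivlMl ?exprn_gt0 // -exprD ler_eXn2l // ltnW.
  have l1' : p%:R ^+ m <= padic_abs (l j) ^+ w i.
    apply: (le_trans l1 _); rewrite ler_eXnr // ?w_gt0 //.
    by apply: le_trans l1; rewrite exp_p_ge1.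
  have -> : 1 = p%:R ^+ m * (p%:R ^+ m)^-1 :> R by rewrite mulfV // expf_neq0 // gt_eqF.
  apply: (@le_lt_trans _ _ (padic_abs (l j) ^+ w i * (p%:R ^+ m)^-1)).
    by rewrite ler_wpM2r ?invr_ge0 ?exprn_ge0 ?(ltW p_gt0).
  by rewrite ltr_pM2l //; apply: lt_le_trans l1'; rewrite exprn_gt0.
case: (ex_maxnP P0 Pbound) => j /asboolP Pj jmax.
have l0 : l j != 0 by rewrite mulf_neq0 ?invr_eq0 ?pX0.
exists (l j) => //; split => //.
have : ~ polydisc 1 (weighted_scale (l j.+1) x).
  by move=> /asboolP/jmax; rewrite ltnn.
move=> /existsNP[i' /negP]; rewrite -ltNge => xi'; exists i'; apply: ltW.
move: xi'; rewrite !mxE !padic_absM !padic_absX !labs exprS.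
rewrite [_ * (p%:R * _)]mulrCA exprMn -mulrA => h.
by rewrite -[ltLHS]mulr1 ltr_pdivrMl ?exprn_gt0.
Qed.

(** On the compact shell |f| is nonzero and locally constant. Both bounds share one [N], so the
    condition is monotone in [N] and compactness gives a common value. *)
Lemma padic_eval_shell_bounds : exists N : nat, forall x, weighted_shell x ->
  (p%:R ^+ N)^-1 <= padic_abs (padic_eval f x) <= p%:R ^+ N.
Proof.
pose P (N : nat) x := (p%:R ^+ N)^-1 <= padic_abs (padic_eval f x) <= p%:R ^+ N.
have /compact_near_coveringP/(_ nat \oo P _)[x /weighted_shell_neq0 x0|N _ NP] :=
  weighted_shell_compact; last by exists N => x Kx; exact: (NP N (leqnn N) x Kx).
have fx0 : 0 < padic_abs (padic_eval f x).
  by rewrite padic_abs_gt0; apply/eqP => /padic_eval_eq0/eqP; rewrite (negbTE x0).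
have [k fk] := padic_abs_le_pX (padic_eval f x).
have [m fm] := exp_pV_lt p_pr fx0.
exists ([set y | padic_abs (padic_eval f y) = padic_abs (padic_eval f x)],
  [set l | (maxn m k <= l)%N]).
  by split; [exact: padic_eval_abs_near|exists (maxn m k)].
move=> [y l] [/= ye]; rewrite geq_max => /andP[ml kl]; rewrite /P ye.
apply/andP; split; last by apply: (le_trans fk); rewrite ler_eXn2l.
apply: (le_trans _ (ltW fm)).
exact: exp_pV_le.
Qed.

(** One term suffices: (p^-w_i)^(d / w_i) = p^-d whichever coordinate [i] is large. *)
Lemma quasi_norm_shell_ge x : weighted_shell x -> p%:R `^ (- d%:R) <= quasi_norm d w x.
Proof.
move=> [_ [i xi]]; rewrite /quasi_norm (bigD1 i) //=.
apply: (@le_trans _ _ (padic_abs (x 0 i) `^ (d%:R / (w i)%:R))); last first.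
  by rewrite lerDl; apply: sumr_ge0 => j _; apply: powR_ge0.
have -> : p%:R `^ (- d%:R) = ((p%:R ^+ w i)^-1) `^ (d%:R / (w i)%:R) :> R.
  rewrite -powR_mulrn ?(ltW p_gt0) // -powRN -powRrM; congr (_ `^ _).
  by rewrite mulNr mulrC divfK // pnatr_eq0 -lt0n.
by apply: ge0_ler_powR; rewrite ?nnegrE ?padic_abs_ge0 ?divr_ge0 ?invr_ge0 ?exprn_ge0 ?(ltW p_gt0).
Qed.

Lemma quasi_norm_polydisc1 x : polydisc 1 x -> quasi_norm d w x <= n%:R.
Proof.
move=> x1; have -> : n%:R = \sum_(i < n) (1 : R) by rewrite sumr_const card_ord.
apply: ler_sum => i _.
apply: (@le_trans _ _ (1 `^ (d%:R / (w i)%:R))); last by rewrite powR1.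
by apply: ge0_ler_powR; rewrite ?nnegrE ?padic_abs_ge0 ?divr_ge0.
Qed.

Lemma quasi_norm_gt0 x : x != 0 -> 0 < quasi_norm d w x.
Proof.
move=> /weighted_shell_scale[l l0 /quasi_norm_shell_ge]; rewrite quasi_norm_scale.
move=> h; rewrite -(pmulr_rgt0 _ (_ : 0 < padic_abs l ^+ d)); last first.
  by rewrite exprn_gt0 // padic_abs_gt0.
by apply: lt_le_trans h; rewrite powR_gt0.
Qed.

Lemma padic_eval_quasi_norm : exists c1 c2 : R, [/\ 0 < c1, 0 < c2 &
  forall x, x != 0 -> c1 * quasi_norm d w x <= padic_abs (padic_eval f x) /\
    padic_abs (padic_eval f x) <= c2 * quasi_norm d w x].
Proof.
have [N fN] := padic_eval_shell_bounds.
have q0 : 0 < p%:R `^ (- d%:R) :> R by rewrite powR_gt0.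
(* On the shell p^-N <= |f| <= p^N and p^-d <= Xi <= n. Both |f| and Xi are multiplied by |l|^d
   under scaling, so the resulting ratio bounds hold everywhere off the origin; [n.+1] keeps the
   first constant positive at once. *)
exists ((p%:R ^+ N)^-1 / n.+1%:R), (p%:R ^+ N / p%:R `^ (- d%:R)); split.
- by rewrite divr_gt0 ?invr_gt0 ?exprn_gt0.
- by rewrite divr_gt0 ?exprn_gt0.
move=> x /weighted_shell_scale[l l0 xK].
have ld0 : 0 < padic_abs l ^+ d by rewrite exprn_gt0 // padic_abs_gt0.
have fE : padic_abs l ^+ d * padic_abs (padic_eval f x) =
    padic_abs (padic_eval f (weighted_scale l x)).
  by rewrite padic_eval_scale // [RHS]padic_absM padic_absX.
have /andP[fl fu] := fN _ xK.
split; rewrite -(ler_pM2l ld0) fE mulrCA -quasi_norm_scale.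
  apply: (le_trans _ fl); rewrite -mulrA ler_piMr ?invr_ge0 ?exprn_ge0 ?(ltW p_gt0) //.
  rewrite ler_pdivrMl // mulr1; apply: le_trans (quasi_norm_polydisc1 xK.1) _.
  by rewrite ler_nat.
apply: (le_trans fu); rewrite -mulrA ler_peMr ?exprn_ge0 ?(ltW p_gt0) //.
by rewrite ler_pdivlMl // mulr1 quasi_norm_shell_ge.
Qed.

Lemma schwartz_bruhat_multiplier (s : R) (g : Qpn -> C) : schwartz_bruhat g ->
  g 0 = 0 -> schwartz_bruhat (fun x => (padic_abs (padic_eval f x) `^ s)%:C%C * g x).
Proof.
move=> gS g0; apply: schwartz_bruhat_mul => // x gx.
have x0 : x != 0 by apply: contraNneq gx => ->; rewrite g0.
by apply: filterS (padic_eval_abs_near x0) => y ->.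
Qed.

Variable mu : {measure set (padic_borel R p_pr n) -> \bar R}.
Hypothesis mu_haar : normalized_haar mu.

Lemma measurable_padic_coord i :
  measurable_fun setT (fun x : padic_borel R p_pr n => padic_abs ((x : Qpn) 0 i)).
Proof.
apply: (measurability _ (measurable_realfun.RGenOInfty.measurableE R)).
move=> _ [_ [a ->] <-]; rewrite setTI; apply: open_borel; rewrite openE => x /=.
rewrite in_itv /= andbT => ax.
(* At a zero coordinate the absolute value is not locally constant, but then a < 0 and the
   superlevel set is everything. *)
have [x0|x0] := eqVneq (x 0 i) 0.
  apply: filterS filterT => y _ /=; rewrite in_itv /= andbT.
  by apply: lt_le_trans (padic_abs_ge0 _); rewrite x0 padic_abs0 in ax.
have [m me] : exists m : nat, (p%:R ^+ m)^-1 < padic_abs (x 0 i).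
  by apply: exp_pV_lt => //; rewrite padic_abs_gt0.
apply/nbhs_polydisc; exists m => y yx /=; rewrite in_itv /= andbT.
have -> // : padic_abs (y 0 i) = padic_abs (x 0 i).
apply: padic_abs_eq_of_lt; rewrite padic_abs_distC; apply: le_lt_trans me.
by have := yx i; rewrite !mxE.
Qed.

Lemma measurable_quasi_norm (s : R) :
  measurable_fun setT (fun x : padic_borel R p_pr n => quasi_norm d w x `^ s).
Proof.
apply: (measurableT_comp (measurable_realfun.measurable_powR s)).
rewrite /quasi_norm; apply: measurable_sum => i.
exact: (measurableT_comp (measurable_realfun.measurable_powR _) (measurable_padic_coord i)).
Qed.

(** For [0 <= s] the weight is bounded on the polydisc supporting [g], which has finite measure. *)
Lemma sobolev_integrable (s : R) (g : Qpn -> C) : 0 <= s -> schwartz_bruhat g ->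
  mu.-integrable setT (EFin \o
    (fun x : padic_borel R p_pr n => quasi_norm d w x `^ s * Normc.normc (g x) ^+ 2)).
Proof.
move=> s0 /step_functionP[N gN]; have [B gB] := step_function_bounded gN.
have normc_ge0 (z : C) : 0 <= Normc.normc z.
  by case: z => u v; apply: sqrtr_ge0.
have [X [X0 XP]] : exists X : R,
    0 <= X /\ forall x, polydisc (p%:R ^+ N) x -> quasi_norm d w x <= X.
  exists (\sum_(i < n) (p%:R ^+ N) `^ (d%:R / (w i)%:R)); split=> [|x xN].
    by apply: sumr_ge0 => i _; apply: powR_ge0.
  apply: ler_sum => i _.
  by apply: ge0_ler_powR; rewrite ?nnegrE ?padic_abs_ge0 ?divr_ge0 ?exprn_ge0 ?(ltW p_gt0).
have gx0 x : ~ polydisc (p%:R ^+ N) x -> g x = 0.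
  by move=> xN; apply/eqP; apply: contra_notT xN => /gN.1.
apply: (integrable_polydisc mu_haar (k := N) (B := X `^ s * B ^+ 2)).
- apply: measurable_realfun.measurable_funM; first exact: measurable_quasi_norm.
  exact: (measurable_step_function (fun z => Normc.normc z ^+ 2) gN).
- by move=> x /gx0 ->; rewrite Normc.normc0 expr0n mulr0.
move=> x; rewrite ger0_norm; last exact: (mulr_ge0 (powR_ge0 _ _) (sqr_ge0 _)).
have [xN|/gx0 ->] := pselect (polydisc (p%:R ^+ N) x); last first.
  rewrite Normc.normc0 expr0n mulr0; exact: (mulr_ge0 (powR_ge0 _ _) (sqr_ge0 _)).
apply: ler_pM; [exact: powR_ge0|exact: sqr_ge0| |].
  by apply: ge0_ler_powR; rewrite ?nnegrE ?quasi_norm_ge0 ?XP.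
apply: lerXn2r; last exact: gB; rewrite nnegrE //.
exact: le_trans (gB x).
Qed.

Lemma sobolev_norm_le (s t c : R) (u v : Qpn -> C) : 0 <= s -> 0 <= t -> 0 <= c ->
  schwartz_bruhat u -> schwartz_bruhat v ->
  (forall x, quasi_norm d w x `^ (2 * s) * Normc.normc (fourier mu u x) ^+ 2 <=
     c ^+ 2 * (quasi_norm d w x `^ (2 * t) * Normc.normc (fourier mu v x) ^+ 2)) ->
  sobolev_norm mu d w s u <= c * sobolev_norm mu d w t v.
Proof.
move=> s0 t0 c0 uS vS uv; rewrite /sobolev_norm.
have -> : c = Num.sqrt (c ^+ 2) by rewrite sqrtr_sqr ger0_norm.
rewrite -sqrtrM ?sqr_ge0 //; apply: ler_wsqrtr.
have iu : mu.-integrable setT (EFin \o (fun x : padic_borel R p_pr n =>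
    quasi_norm d w x `^ (2 * s) * Normc.normc (fourier mu u x) ^+ 2)).
  by apply: sobolev_integrable; [rewrite mulr_ge0|exact: schwartz_bruhat_fourier].
have iv : mu.-integrable setT (EFin \o (fun x : padic_borel R p_pr n =>
    quasi_norm d w x `^ (2 * t) * Normc.normc (fourier mu v x) ^+ 2)).
  by apply: sobolev_integrable; [rewrite mulr_ge0|exact: schwartz_bruhat_fourier].
rewrite -RintegralZl //; apply: le_Rintegral => //.
by have := integrableZl measurableT (c ^+ 2) iv.
Qed.

End Quasielliptic.

(** * Closing a bounded linear graph *)

Section GraphClosure.
Variables (K : numFieldType) (H L : completeNormedModType K).
Implicit Types (G : H -> L -> Prop) (M : K).

Definition graph_closure G (h : H) (k : L) : Prop :=
  forall e : K, 0 < e -> exists h' k', [/\ G h' k', `|h - h'| < e & `|k - k'| < e].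

Definition linear_graph G : Prop := forall (a : K) h h' k k',
  G h k -> G h' k' -> G (a *: h + h') (a *: k + k').

Lemma graph_closure_sub G h k : G h k -> graph_closure G h k.
Proof. by move=> Ghk e e0; exists h, k; rewrite !subrr !normr0. Qed.

Lemma graph_closure_linear G : linear_graph G -> linear_graph (graph_closure G).
Proof.
move=> lG a h h' k k' hk hk' e e0.
have a1 : 0 < `|a| + 1 by rewrite ltr_wpDl.
pose d := e / (`|a| + 1); have d0 : 0 < d by rewrite divr_gt0.
have key (V : normedModType K) (v v' w w' : V) : `|v - v'| < d -> `|w - w'| < d ->
    `|(a *: v + w) - (a *: v' + w')| < e.
  move=> vd wd; rewrite opprD addrACA -scalerBr.
  apply: le_lt_trans (ler_normD _ _) _; rewrite normrZ.
  have -> : e = `|a| * d + d by rewrite -{2}[d]mul1r -mulrDl mulrC divfK // gt_eqF.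
  by rewrite ler_ltD // ler_wpM2l // ltW.
have [h1 [k1 [G1 hh1 kk1]]] := hk _ d0; have [h2 [k2 [G2 hh2 kk2]]] := hk' _ d0.
exists (a *: h1 + h2), (a *: k1 + k2); split; [exact: lG|exact: key|exact: key].
Qed.

Lemma graph_closure_bound G M h k : 0 <= M ->
  (forall h k, G h k -> `|k| <= M * `|h|) -> graph_closure G h k -> `|k| <= M * `|h|.
Proof.
move=> M0 GM hk; apply/ler_addgt0Pr => e e0.
have M1 : 0 < M + 1 by rewrite ltr_wpDl.
pose d := e / (M + 1); have d0 : 0 < d by rewrite divr_gt0.
have [h1 [k1 [/GM G1 hh1 kk1]]] := hk _ d0.
have -> : e = M * d + d by rewrite -{2}[d]mul1r -mulrDl mulrC divfK // gt_eqF.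
rewrite addrA -mulrDr -[k](subrK k1) addrC.
apply: le_trans (ler_normD _ _) _; rewrite lerD ?(ltW kk1) //.
apply: le_trans G1 _; rewrite ler_wpM2l //.
rewrite -[h1](subrK h) addrC; apply: le_trans (ler_normD _ _) _.
by rewrite lerD2l distrC ltW.
Qed.

(** The second coordinates of graph points lying over small balls around [h] generate a filter.
    Linearity and the bound make it Cauchy, and completeness of [L] provides the value. *)
Lemma graph_closure_total G M : 0 <= M -> linear_graph G ->
  (forall h k, G h k -> `|k| <= M * `|h|) ->
  (forall h (e : K), 0 < e -> exists h' k', G h' k' /\ `|h - h'| < e) ->
  forall h, exists k, graph_closure G h k.
Proof.
move=> M0 lG GM dG h.
have M1 : 0 < M + 1 by rewrite ltr_wpDl.
pose F := filter_from [set e : K | 0 < e]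
  (fun e => [set k : L | exists2 h', G h' k & `|h - h'| < e]).
have FF : ProperFilter F.
  apply: filter_from_proper; last by move=> e /(dG h)[h' [k' [hk he]]]; exists k', h'.
  apply: filter_from_filter; first by exists 1 => /=.
  (* The order of [K] is partial; positive elements are real, hence comparable, as the minimum
     requires. *)
  move=> i j /= i0 j0; have ij : (i >=< j)%O by rewrite real_comparable ?gtr0_real.
  exists (Num.min i j); first by rewrite /= comparable_lt_min ?i0.
  move=> k [h' hk]; rewrite comparable_lt_min // => /andP[hi hj].
  by split; exists h'.
have cF : cauchy F.
  apply: cauchy_exP => e e0.
  (* Two graph points over the [d]-ball have first coordinates less than 2d apart, so second ones at
     most 2dM < e apart; [M + 1] stays positive when [M] is 0. *)
  pose d := e / (M + 1) / 2.
  have d0 : 0 < d by rewrite !divr_gt0.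
  have [h1 [k1 [G1 hh1]]] := dG h _ d0.
  exists k1; exists d => // k2 [h2 G2 hh2]; rewrite -ball_normE /=.
  have /GM : G (h1 - h2) (k1 - k2).
    by have := lG (-1) _ _ _ _ G2 G1; rewrite !scaleN1r ![- _ + _]addrC.
  move=> /le_lt_trans; apply.
  have -> : e = (M + 1) * (d + d).
    by rewrite /d -splitr mulrC divfK // gt_eqF.
  rewrite mulrDl mul1r ltr_pwDr ?addr_gt0 // ler_wpM2l //.
  rewrite -[h1](subrK h) -addrA; apply: le_trans (ler_normD _ _) _.
  by rewrite lerD // ltW // distrC.
have cvF : (id @ F --> lim F) by exact: (@cauchy_cvg L F FF cF).
have /cvgrPdist_lt Fk := cvF.
exists (lim F) => e e0.
have Fe : F [set k : L | exists2 h', G h' k & `|h - h'| < e] by exists e.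
by have [k [/= ke [h' hk he]]] := filter_ex (filterI (Fk e e0) Fe); exists h', k.
Qed.

(** Two values over the same point differ by a value over 0, which the bound forces to be 0.
    Linearity and continuity then pass from the closed graph to the map. *)
Lemma graph_extension G M : 0 <= M -> linear_graph G ->
  (forall h k, G h k -> `|k| <= M * `|h|) ->
  (forall h (e : K), 0 < e -> exists h' k', G h' k' /\ `|h - h'| < e) ->
  exists T : {linear H -> L},
    continuous T /\ forall h k, graph_closure G h k <-> k = T h.
Proof.
move=> M0 lG GM dG.
have /choice[T0 T0P] := graph_closure_total M0 lG GM dG.
have lG' := graph_closure_linear lG.
have uniq h k k' : graph_closure G h k -> graph_closure G h k' -> k = k'.
  move=> hk hk'; have := lG' (-1) _ _ _ _ hk' hk; rewrite !scaleN1r addNr addrC.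
  move=> /(graph_closure_bound M0 GM); rewrite normr0 mulr0 normr_le0 subr_eq0.
  by move/eqP.
have T0lin : linear T0.
  by move=> a u v; apply: (uniq (a *: u + v)) => //; apply: lG'.
pose T : {linear H -> L} := HB.pack T0 (GRing.isLinear.Build K H L *:%R T0 T0lin).
exists T; split => [x|h k]; last first.
  by split => [|->]; [move/uniq; apply|]; exact: T0P.
apply/cvgrPdist_lt => e e0.
have M1 : 0 < M + 1 by rewrite ltr_wpDl.
apply/nbhs_ballP; exists (e / (M + 1)); first by rewrite /= divr_gt0.
move=> y; rewrite -ball_normE /= ltr_pdivlMr // => xy.
have -> : T0 x - T0 y = T (x - y) by rewrite linearB.
apply: le_lt_trans (graph_closure_bound M0 GM (T0P (x - y))) _.
by apply: le_lt_trans xy; rewrite mulrC ler_wpM2l // lerDl.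
Qed.

End GraphClosure.

Lemma graph_closure_flip (K : numFieldType) (H L : completeNormedModType K)
    (G : H -> L -> Prop) h k :
  graph_closure G h k -> graph_closure (fun k h => G h k) k h.
Proof. by move=> hk e /hk[h' [k' [? ? ?]]]; exists k', h'. Qed.

(** [T] and [S] come from [G] and its transpose; closing commutes with transposing, so their graphs
    are transposes of each other. *)
Lemma graph_isomorphism (K : numFieldType) (H L : completeNormedModType K)
    (G : H -> L -> Prop) (M M' : K) :
  0 <= M -> 0 <= M' -> linear_graph G ->
  (forall h k, G h k -> `|k| <= M * `|h|) ->
  (forall h k, G h k -> `|h| <= M' * `|k|) ->
  (forall h (e : K), 0 < e -> exists h' k', G h' k' /\ `|h - h'| < e) ->
  (forall k (e : K), 0 < e -> exists h' k', G h' k' /\ `|k - k'| < e) ->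
  exists (T : {linear H -> L}) (S : {linear L -> H}),
    [/\ forall h k, G h k -> T h = k, continuous T,
        cancel T S, cancel S T & continuous S].
Proof.
move=> M0 M0' lG GM GM' dH dL.
have [T [cT TP]] := graph_extension M0 lG GM dH.
have [S [cS SP]] : exists S : {linear L -> H},
    continuous S /\ forall k h, graph_closure (fun k h => G h k) k h <-> h = S k.
  apply: (graph_extension M0') => [a k k' h h'|k h /GM' //|k e /(dL k)[h' [k' [? ?]]]].
    exact: lG.
  by exists k', h'.
exists T, S; split => // [h k /graph_closure_sub/TP //|h|k].
  by apply/esym/SP/graph_closure_flip/TP.
by apply/esym/TP/(@graph_closure_flip _ _ _ (fun k h => G h k))/SP.
Qed.

(** * The operator on the completions *)

Section Multiplier.
Variables (R : realType) (p : nat) (p_pr : prime p) (n : nat).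
Local Notation Qp := (padicQ R p_pr).
Local Notation Qpn := 'rV[Qp]_n.
Local Notation C := R[i].
Variable mu : {measure set (padic_borel R p_pr n) -> \bar R}.
Hypothesis mu_haar : normalized_haar mu.
Variables (f : mpoly.mpoly n Qp) (d : nat) (w : 'I_n -> nat).
Hypotheses (f_int : padic_integral_coeffs f) (f_qell : quasielliptic f d w).

Lemma lizorkin_linear (a : C) (u v : Qpn -> C) :
  lizorkin mu u -> lizorkin mu v -> lizorkin mu (a *: u + v).
Proof.
move=> [uS u0] [vS v0]; split; first exact: schwartz_bruhatD.
by have := fourier_linear mu_haar a uS vS => ->; rewrite u0 v0 mulr0 add0r.
Qed.

Definition multiplier_related (s : R) (u v : Qpn -> C) : Prop :=
  [/\ lizorkin mu u, lizorkin mu v & fourier mu v =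
    fun xi => (padic_abs (padic_eval f xi) `^ s)%:C%C * fourier mu u xi].

Lemma multiplier_related_ex s u : lizorkin mu u -> exists v, multiplier_related s u v.
Proof.
move=> [uS u0].
have [|v vS vE] := fourier_surjective mu_haar (g := fun xi =>
    (padic_abs (padic_eval f xi) `^ s)%:C%C * fourier mu u xi).
  by apply: (schwartz_bruhat_multiplier f_int f_qell) => //; apply: schwartz_bruhat_fourier.
by exists v; split => //; split => //; rewrite vE u0 mulr0.
Qed.

(** Off the origin the powers of |f| cancel; at the origin they do not, but both transforms vanish
    there. *)
Lemma multiplier_related_opp s u v : multiplier_related (- s) v u -> multiplier_related s u v.
Proof.
move=> [vL uL uE]; split => //; rewrite uE; apply/funext => xi.
have [->|xi0] := eqVneq xi 0; first by rewrite vL.2 !mulr0.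
have f0 : padic_abs (padic_eval f xi) != 0.
  by rewrite padic_abs_eq0; apply/eqP => /(padic_eval_eq0 f_qell)/eqP; rewrite (negbTE xi0).
rewrite mulrA -rmorphM /= -powRD; last by rewrite f0 implybT.
by rewrite subrr powRr0 mul1r.
Qed.

Lemma multiplier_related_linear s a u v u' v' :
  multiplier_related s u v -> multiplier_related s u' v' ->
  multiplier_related s (a *: u + u') (a *: v + v').
Proof.
move=> [uL vL vE] [uL' vL' vE']; split; try exact: lizorkin_linear.
have := fourier_linear mu_haar a uL.1 uL'.1 => ->.
have := fourier_linear mu_haar a vL.1 vL'.1 => ->.
by rewrite vE vE'; apply/funext => xi; ring.
Qed.

(** Surjectivity supplies a preimage, so [xget] returns one rather than its default. *)
Lemma pseudodiff_related s u : lizorkin mu u -> multiplier_related s u (pseudodiff mu f s u).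
Proof.
move=> uL; have [v [_ [vS v0] vE]] := multiplier_related_ex s uL.
have [pS pE] : schwartz_bruhat (pseudodiff mu f s u) /\
    fourier mu (pseudodiff mu f s u) = fourier mu v.
  rewrite /pseudodiff /inverse_fourier; case: xgetP => [psi _ [psiS psiE]|/(_ v)].
    by rewrite vE.
  by case; split.
by split => //; [split => //; rewrite pE|rewrite pE].
Qed.

Lemma multiplier_related_norm (alpha beta : R) : 0 < alpha -> alpha <= beta ->
  exists M M' : R, [/\ 0 <= M, 0 <= M' & forall u v, multiplier_related alpha u v ->
    sobolev_norm mu d w (beta - alpha) v <= M * sobolev_norm mu d w beta u /\
    sobolev_norm mu d w beta u <= M' * sobolev_norm mu d w (beta - alpha) v].
Proof.
move=> a0 ab; have [c1 [c2 [c1_gt0 c2_gt0 fb]]] := padic_eval_quasi_norm f_int f_qell.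
have ba : 0 <= beta - alpha by rewrite subr_ge0.
have b0 : 0 <= beta by apply: le_trans ab; apply: ltW.
have K1 : 0 < c1 `^ alpha by rewrite powR_gt0.
have K2 : 0 < c2 `^ alpha by rewrite powR_gt0.
exists (c2 `^ alpha), (c1 `^ alpha)^-1; split; rewrite ?invr_ge0 ?(ltW K1) ?(ltW K2) //.
move=> u v [[uS u0] [vS v0] vE].
(* Both integrands contain q z with [q] = Xi^(2 (beta - alpha)) and [z] = |Fu|^2; they differ by [a]
   = Xi^alpha against [b] = |f|^alpha. Where Fu vanishes, in particular at the origin, four zeros
   serve. *)
have key xi : exists q a b z : R, [/\ 0 <= q /\ 0 <= z, 0 <= b /\ 0 <= a,
   b <= c2 `^ alpha * a /\ c1 `^ alpha * a <= b,
   quasi_norm d w xi `^ (2 * beta) * Normc.normc (fourier mu u xi) ^+ 2 = q * (a ^+ 2 * z) &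
   quasi_norm d w xi `^ (2 * (beta - alpha)) * Normc.normc (fourier mu v xi) ^+ 2
     = q * (b ^+ 2 * z)].
  have [ux0|ux0] := eqVneq (fourier mu u xi) 0.
    exists 0, 0, 0, 0; rewrite vE ux0 !(mulr0, mul0r, Normc.normc0) expr0n /= !mulr0.
    by rewrite !lexx.
  have xi0 : xi != 0 by apply: contraNneq ux0 => ->; rewrite u0.
  have q0 := quasi_norm_gt0 f_qell xi0; have [fl fu] := fb xi xi0.
  exists (quasi_norm d w xi `^ (2 * (beta - alpha))), (quasi_norm d w xi `^ alpha),
    (padic_abs (padic_eval f xi) `^ alpha), (Normc.normc (fourier mu u xi) ^+ 2).
  split; [by split; [exact: powR_ge0|exact: sqr_ge0]|by split; exact: powR_ge0| | |].
  - rewrite -!powRM ?(ltW q0) ?(ltW c1_gt0) ?(ltW c2_gt0) //.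
    split; apply: ge0_ler_powR => //; rewrite ?nnegrE ?(ltW a0) ?padic_abs_ge0 //.
      by rewrite mulr_ge0 ?(ltW q0) ?(ltW c2_gt0).
    by rewrite mulr_ge0 ?(ltW q0) ?(ltW c1_gt0).
  - have -> : 2 * beta = 2 * (beta - alpha) + alpha * 2 by ring.
    rewrite powRD ?(gt_eqF q0) ?implybT // (powRrM _ alpha 2) powR_mulrn ?powR_ge0 //.
    by rewrite mulrA.
  rewrite vE Normc.normcM exprMn; congr (_ * (_ ^+ 2 * _)).
  by rewrite /= expr0n addr0 sqrtr_sqr ger0_norm ?powR_ge0.
split.
  apply: sobolev_norm_le => // [|xi]; first exact: ltW.
  have [q [a [b [z [[q0 z0] [b_ge0 a_ge0] [bK _] -> ->]]]]] := key xi.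
  rewrite [leRHS]mulrCA ler_wpM2l // [leRHS]mulrA -exprMn ler_wpM2r // lerXn2r ?nnegrE //.
  by rewrite mulr_ge0 ?(ltW K2).
apply: sobolev_norm_le => // [|xi]; first by rewrite invr_ge0 ltW.
have [q [a [b [z [[q0 z0] [b_ge0 a_ge0] [_ bK] -> ->]]]]] := key xi.
rewrite [leRHS]mulrCA ler_wpM2l // [leRHS]mulrA -exprMn ler_wpM2r // lerXn2r ?nnegrE //.
  by rewrite mulr_ge0 ?invr_ge0 ?(ltW K1).
by rewrite ler_pdivlMl.
Qed.

End Multiplier.

Lemma dense_near (K : numFieldType) (V : normedModType K) (S : set V) (h : V) (e : K) :
  dense S -> 0 < e -> exists2 s, S s & `|h - s| < e.
Proof.
move=> dS e0; have [] := dS (ball h e)^°.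
- by exists h; apply: nbhsx_ballx.
- exact: open_interior.
- by move=> s [/interior_subset]; rewrite -ball_normE /=; exists s.
Qed.

Lemma continuous_eq_dense (K : numFieldType) (V W : normedModType K) (S : set V)
    (T T' : V -> W) : continuous T -> continuous T' -> dense S ->
  (forall s, S s -> T s = T' s) -> T =1 T'.
Proof.
move=> cT cT' dS TT' h; apply/eqP; rewrite -subr_eq0 -normr_le0.
apply/ler_addgt0Pr => e e0; rewrite add0r.
have e2 : 0 < e / 2 by rewrite divr_gt0.
have /cvgrPdist_lt/(_ _ e2) nT := cT h; have /cvgrPdist_lt/(_ _ e2) nT' := cT' h.
have /nbhs_ballP[r r0 hr] : nbhs h ([set t | `|T h - T t| < e / 2] `&`
    [set t | `|T' h - T' t| < e / 2]) by apply: filterI.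
have [s Ss hs] := dense_near h dS r0.
have [/= h1 h2] : (`|T h - T s| < e / 2) /\ (`|T' h - T' s| < e / 2).
  by apply: hr; rewrite -ball_normE.
have -> : T h - T' h = (T h - T s) - (T' h - T' s).
  by rewrite (TT' s Ss) opprB addrA subrK.
rewrite [leRHS]splitr; apply: le_trans (ler_normB _ _) _.
by rewrite lerD // ltW.
Qed.

Theorem theorem5p5 (R : realType) (p : nat) (p_pr : prime p) (n : nat)
  (mu : {measure set (padic_borel R p_pr n) -> \bar R})
  (mu_haar : normalized_haar mu)
  (f : mpoly.mpoly n (padicQ R p_pr)) (d : nat) (w : 'I_n -> nat)
  (f_int : padic_integral_coeffs f) (f_qell : quasielliptic f d w)
  (alpha beta : R) (alpha_gt0 : 0 < alpha) (alpha_beta : alpha <= beta)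
  (H K : completeNormedModType R[i])
  (iotaH : ('rV[padicQ R p_pr]_n -> R[i]) -> H)
  (iotaK : ('rV[padicQ R p_pr]_n -> R[i]) -> K)
  (complH : is_completion (lizorkin mu) (sobolev_norm mu d w beta) iotaH)
  (complK :
     is_completion (lizorkin mu) (sobolev_norm mu d w (beta - alpha)) iotaK) :
  exists T : {linear H -> K},
    [/\ extension_by_density (lizorkin mu) iotaH iotaK (pseudodiff mu f alpha) T,
        forall T' : {linear H -> K},
          extension_by_density (lizorkin mu) iotaH iotaK
            (pseudodiff mu f alpha) T' -> T' =1 T
      & bicontinuous_isomorphism T].
Proof.
pose rel := multiplier_related mu f alpha.
(* Several [u] may have the same image in [H], so [G] starts as a relation; the norm bounds make it
   a graph in both directions. *)
pose G (h : H) (k : K) := exists u v, [/\ rel u v, h = iotaH u & k = iotaK v].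
have [M [M' [M0 M0' MM]]] :=
  multiplier_related_norm mu_haar f_int f_qell alpha_gt0 alpha_beta.
have lG : linear_graph G.
  move=> a _ _ _ _ [u [v [uv -> ->]]] [u' [v' [uv' -> ->]]].
  exists (a *: u + u'), (a *: v + v'); split; first exact: multiplier_related_linear.
    by case: uv uv' => [? _ _] [? _ _]; rewrite (completion_linear complH).
  by case: uv uv' => [_ ? _] [_ ? _]; rewrite (completion_linear complK).
have [||h k [u [v [uv -> ->]]]|h k [u [v [uv -> ->]]]|h e e0|k e e0|] :=
  @graph_isomorphism _ H K G M%:C%C M'%:C%C _ _ lG.
- by rewrite lecR.
- by rewrite lecR.
- case: (uv) => uL vL _; rewrite (completion_isometry complH uL) (completion_isometry complK vL).
  by rewrite -rmorphM lecR (MM _ _ uv).1.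
- case: (uv) => uL vL _; rewrite (completion_isometry complH uL) (completion_isometry complK vL).
  by rewrite -rmorphM lecR (MM _ _ uv).2.
- have [_ [u uL <-] hu] := dense_near h (completion_dense complH) e0.
  have [v uv] := multiplier_related_ex mu_haar f_int f_qell alpha uL.
  by exists (iotaH u), (iotaK v); split => //; exists u, v.
- have [_ [v vL <-] hv] := dense_near k (completion_dense complK) e0.
  (* A preimage of [v] comes from the multiplier with exponent [- alpha]; the relation is then
     reversed. *)
  have [u vu] := multiplier_related_ex mu_haar f_int f_qell (- alpha) vL.
  have uv := multiplier_related_opp f_qell vu.
  by exists (iotaH u), (iotaK v); split => //; exists u, v.
move=> T [S [TG cT TS ST cS]].
have TE u : lizorkin mu u -> lizorkin mu (pseudodiff mu f alpha u) /\
    T (iotaH u) = iotaK (pseudodiff mu f alpha u).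
  move=> uL; have ur := pseudodiff_related mu_haar f_int f_qell alpha uL.
  by split; [case: ur|apply: TG; exists u, (pseudodiff mu f alpha u)].
exists T; split; [by split| |by split => //; exists S].
move=> T' [cT' T'E]; apply: (continuous_eq_dense cT' cT (completion_dense complH)).
by move=> _ [u uL <-]; rewrite (T'E u uL).2 (TE u uL).2.
Qed.
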